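(* Let $V$ be a JB-algebra with positive cone $\Omega$. For every $x,y\in\Omega$ we have $d'(x,y)=\mathrm{dist}_\Omega(x,y)$.
   Context: A JB-algebra is a real Banach space $V$ with a bilinear commutative product $\circ$ and unit $1$ such that $x^2\circ(x\circ y)=x\circ(x^2\circ y)$, $\|x\circ y\|\le\|x\|\|y\|$, $\|x^2\|=\|x\|^2$ and $\|x^2\|\le\|x^2+y^2\|$. $L_xy=x\circ y$, $U_x=2L_x^2-L_{x^2}$. $\Omega$ is the open convex cone of elements with spectrum in $(0,\infty)$; square roots $p^{1/2}$, $p^{-1/2}$ of $p\in\Omega$ are given by functional calculus. $B(V)$ is the algebra of bounded operators with operator norm $\|\cdot\|$. $G(\Omega)$ is the group of invertible $g\in B(V)$ with $g(\Omega)=\Omega$; it is an embedded Banach-Lie subgroup of the group $GL(V)$ of invertible elements of $B(V)$, with Lie algebra $\mathfrak{str}(V)=\{L_x:x\in V\}\oplus\mathrm{Der}(V)$, where $\mathrm{Der}(V)$ is the space of bounded derivations of $V$. It acts transitively on $\Omega$ by $(g,p)\mapsto g(p)$, and the stabilizer of $1$ is the group $\mathrm{Aut}(V)$ of Jordan automorphisms of $V$ (bounded invertible linear $k$ with $k(1)=1$, $k(a\circ b)=k(a)\circ k(b)$). On $\Omega$: $\|v\|_p=\|U_{p^{-1/2}}v\|$ for $p\in\Omega$, $v\in T_p\Omega\simeq V$, $\mathrm{Length}_\Omega(\gamma)=\int\|\gamma'\|_\gamma\,dt$, and $\mathrm{dist}_\Omega$ is the infimum of lengths of piecewise $C^1$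 paths in $\Omega$ joining the points. On $G(\Omega)$: $\|H\|_g=\|g^{-1}H\|$ (operator norm) for $H\in T_gG(\Omega)=g\,\mathfrak{str}(V)$, and $\mathrm{dist}_{G(\Omega)}$ is the infimum of lengths $\int\|\alpha^{-1}\alpha'\|dt$ of piecewise $C^1$ paths $\alpha$ in $G(\Omega)$ joining the points ($+\infty$ if there are none). For $x,y\in\Omega$ choose $g,h\in G(\Omega)$ with $g(1)=x$, $h(1)=y$ and put $d'(x,y)=\inf_{k_1,k_2\in\mathrm{Aut}(V)}\mathrm{dist}_{G(\Omega)}(gk_1,hk_2)$; this does not depend on the choice of $g,h$. *)

(* Defs.v *)
From HB Require Import structures.
From mathcomp Require Import all_boot all_order all_algebra.
From mathcomp Require Import all_classical all_reals all_analysis.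

Set Implicit Arguments.
Unset Strict Implicit.
Unset Printing Implicit Defensive.

Import Order.TTheory GRing.Theory Num.Theory.
Import numFieldNormedType.Exports.

Local Open Scope classical_set_scope.
Local Open Scope ring_scope.

(* Right linearity of the product follows from left linearity and
   commutativity. *)
HB.mixin Record isJBAlgebra (R : realType) V of CompleteNormedModule R V := {
  jmul : V -> V -> V;
  jone : V;
  jmul_linear : forall y : V, linear (fun x => jmul x y);
  jmulC : commutative jmul;
  jmul1x : left_id jone jmul;
  jordan_id : forall x y : V,
    jmul (jmul x x) (jmul x y) = jmul x (jmul (jmul x x) y);
  jnormM : forall x y : V, `|jmul x y| <= `|x| * `|y|;
  jnorm_sqr : forall x : V, `|jmul x x| = `|x| ^+ 2;
  jnorm_sqrD : forall x y : V, `|jmul x x| <= `|jmul x x + jmul y y|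
}.

#[short(type="jbAlgType")]
HB.structure Definition JBAlgebra (R : realType) :=
  {V of isJBAlgebra R V & CompleteNormedModule R V}.

Section BoundedOperators.
Variables (R : realType) (V : normedModType R).

(* The space B(V) of bounded operators with the operator norm. *)
Definition bounded_linear_pred : {pred V -> V} := fun f =>
  `[< linear f /\ exists M : R, forall v, `|f v| <= M * `|v| >].

Lemma bounded_linear_submod_closed : submod_closed bounded_linear_pred.
Proof.
split.
  apply/asboolP; split.
    by move=> a u v; rewrite /= scaler0 addr0.
  by exists 0 => v; rewrite normr0 mul0r.
move=> a f g /asboolP[lf [M Mf]] /asboolP[lg [N Ng]]; apply/asboolP; split.
  move=> b u v.
  have E w : (a *: f + g) w = a *: f w + g w by [].
  by rewrite !E lf lg !scalerDr !scalerA [b * a]mulrC addrACA.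
exists (`|a| * M + N) => v.
rewrite [X in `|X|]/(a *: f v + g v) (le_trans (ler_normD _ _))//.
by rewrite normrZ mulrDl -mulrA lerD// ler_wpM2l.
Qed.

HB.instance Definition _ := GRing.isSubmodClosed.Build R (V -> V)
  bounded_linear_pred bounded_linear_submod_closed.

Record bop := BOp { bop_fun :> V -> V; _ : bop_fun \in bounded_linear_pred }.

HB.instance Definition _ := [isSub for bop_fun].
HB.instance Definition _ := [Choice of bop by <:].
HB.instance Definition _ := [SubChoice_isSubLmodule of bop by <:].

Lemma bop_linear (f : bop) : linear f.
Proof. by case: f => f /= /asboolP[]. Qed.

Lemma bop_bounded (f : bop) : exists M : R, forall v, `|f v| <= M * `|v|.
Proof. by case: f => f /= /asboolP[]. Qed.

Lemma bopP (f g : bop) : f =1 g -> f = g.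
Proof. by move=> fg; apply/val_inj/funext. Qed.

HB.instance Definition _ (f : bop) :=
  GRing.isLinear.Build R V V _ (bop_fun f) (bop_linear f).

Definition opnorm (f : bop) : R :=
  sup [set `|f v| | v in [set v : V | `|v| <= 1]].

Lemma opnorm_has_sup (f : bop) :
  has_sup [set `|f v| | v in [set v : V | `|v| <= 1]].
Proof.
split; first by exists `|f 0|, 0 => //=; rewrite normr0.
have [M Mf] := bop_bounded f; exists `|M| => _ [v /= v1 <-].
rewrite (le_trans (Mf v))// (le_trans (ler_norm _))// normrM normr_id.
by rewrite -[leRHS]mulr1 ler_wpM2l.
Qed.

Lemma le_opnorm (f : bop) (v : V) : `|v| <= 1 -> `|f v| <= opnorm f.
Proof.
by move=> v1; apply: ub_le_sup; [case: (opnorm_has_sup f)|exists v].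
Qed.

Lemma opnorm_le (f : bop) (M : R) :
  (forall v, `|v| <= 1 -> `|f v| <= M) -> opnorm f <= M.
Proof.
move=> fM; apply: ge_sup; first by case: (opnorm_has_sup f).
by move=> _ [v v1 <-]; exact: fM.
Qed.

Lemma opnormP (f : bop) (v : V) : `|f v| <= opnorm f * `|v|.
Proof.
have [->|v0] := eqVneq v 0; first by rewrite linear0 !normr0 mulr0.
have : `|f (`|v|^-1 *: v)| <= opnorm f.
  by apply: le_opnorm; rewrite normfZV.
by rewrite linearZ normrZ normfV normr_id mulrC ler_pdivrMr// normr_gt0.
Qed.

Lemma opnormD (f g : bop) : opnorm (f + g) <= opnorm f + opnorm g.
Proof.
apply: opnorm_le => v v1; rewrite [X in `|X|]/(f v + g v).
by rewrite (le_trans (ler_normD _ _))// lerD// le_opnorm.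
Qed.

Lemma opnormZ_le (a : R) (f : bop) : opnorm (a *: f) <= `|a| * opnorm f.
Proof.
apply: opnorm_le => v v1; rewrite [X in `|X|]/(a *: f v).
by rewrite normrZ ler_wpM2l// le_opnorm.
Qed.

Lemma opnormZ (a : R) (f : bop) : opnorm (a *: f) = `|a| * opnorm f.
Proof.
apply/eqP; rewrite eq_le opnormZ_le/=.
have [->|a0] := eqVneq a 0.
  rewrite normr0 mul0r (le_trans (normr_ge0 ((0 *: f) 0)))//.
  by apply: le_opnorm; rewrite normr0.
have := opnormZ_le a^-1 (a *: f).
rewrite scalerA mulVf// scale1r normfV => fle.
by rewrite -ler_pdivlMl ?normr_gt0.
Qed.

Lemma opnorm0_eq0 (f : bop) : opnorm f = 0 -> f = 0.
Proof.
move=> f0; apply: bopP => v; apply/eqP; rewrite -normr_le0.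
by rewrite (le_trans (opnormP f v))// f0 mul0r.
Qed.

HB.instance Definition _ :=
  Lmodule_isNormed.Build R bop opnormD opnormZ opnorm0_eq0.

Lemma bid_subproof : idfun \in bounded_linear_pred.
Proof. by apply/asboolP; split=> //; exists 1 => v; rewrite mul1r. Qed.

Definition bid : bop := BOp bid_subproof.

Lemma bcomp_subproof (f g : bop) : f \o g \in bounded_linear_pred.
Proof.
apply/asboolP; split; first by move=> a u v /=; rewrite !linearP.
exists (opnorm f * opnorm g) => v /=.
rewrite (le_trans (opnormP f _))// -mulrA ler_wpM2l ?opnormP//.
by rewrite (le_trans (normr_ge0 (f 0)))// le_opnorm// normr0.
Qed.

Definition bcomp (f g : bop) : bop := BOp (bcomp_subproof f g).

Definition is_binv (f g : bop) := bcomp f g = bid /\ bcomp g f = bid.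

Definition GL : set bop := [set f | exists g, is_binv f g].

(* Meaningful on GL only. *)
Definition binv (f : bop) : bop := get [set g | is_binv f g].

End BoundedOperators.

Section PathDistance.
Variables (R : realType) (E : normedModType R).

(* At the endpoints of [a, b] the derivative is one-sided. *)
Definition C1_on (c : R -> E) (a b : R) := exists c' : R -> E,
  {within `[a, b], continuous c'} /\
  forall t, t \in `[a, b] ->
    (s - t)^-1 *: (c s - c t) @[s --> within `[a, b] t^'] --> c' t.

Definition piecewise_C1 (c : R -> E) (a b : R) :=
  exists2 s : seq R, itv_partition a b s &
    forall i, (i < size s)%N -> C1_on c (nth b (a :: s) i) (nth b s i).

(* Finsler length for the norms N p on the tangent spaces; the derivative
   exists outside the finitely many partition points of a piecewise C^1 path. *)
Definition path_length (N : E -> E -> R) (c : R -> E) (a b : R) : \bar R :=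
  (\int[lebesgue_measure]_(t in `[a, b]) (N (c t) (derive1 c t))%:E)%E.

Definition path_in (S : set E) (p q : E) (c : R -> E) (a b : R) :=
  [/\ a < b, piecewise_C1 c a b, forall t, t \in `[a, b] -> S (c t),
      c a = p & c b = q].

Definition path_dist (S : set E) (N : E -> E -> R) (p q : E) : \bar R :=
  ereal_inf [set l | exists c a b,
    path_in S p q c a b /\ l = path_length N c a b].

End PathDistance.

Section JBAlgebraTheory.
Variables (R : realType) (V : jbAlgType R).
Implicit Types (x y p v : V) (g h : bop V).

Local Notation "1J" := (@jone R V).

Definition Uop x v : V := 2 *: jmul x (jmul x v) - jmul (jmul x x) v.

Definition jinvertible x :=
  exists y, jmul x y = 1J /\ jmul (jmul x x) y = x.

(* In a JB-algebra this is the spectrum of x in the closed associative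
   subalgebra generated by x and 1. *)
Definition jspectrum x : set R := [set t | ~ jinvertible (x - t *: 1J)].

Definition Omega : set V := [set x | jspectrum x `<=` [set t | 0 < t]].

Definition jpow x (n : nat) : V := iter n (jmul x) 1J.

Definition jhorner (P : {poly R}) x : V :=
  \sum_(i < size P) P`_i *: jpow x i.

(* Continuous functional calculus: f(x) is the limit of P(x) for polynomials P
   tending to f uniformly on the spectrum of x. *)
Definition is_fcalc (f : R -> R) x y := forall e : R, 0 < e ->
  exists P : {poly R},
    (forall t, jspectrum x t -> `|P.[t] - f t| <= e) /\ `|jhorner P x - y| <= e.

Definition fcalc (f : R -> R) x : V := get [set y | is_fcalc f x y].

Definition jsqrtV p : V := fcalc (fun t => (Num.sqrt t)^-1) p.

Definition tnormO p v : R := `|Uop (jsqrtV p) v|.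

Definition distO x y : \bar R := path_dist Omega tnormO x y.

Definition GOmega : set (bop V) :=
  [set g | GL g /\ [set g v | v in Omega] = Omega].

(* GOmega is an embedded submanifold of the Banach space bop V, so that C^1
   paths in GOmega are the C^1 paths in bop V with values in GOmega. *)
Definition tnormG g (H : bop V) : R := `|bcomp (binv g) H|.

Definition distG g h : \bar R := path_dist GOmega tnormG g h.

Definition AutV : set (bop V) := [set k | [/\ GL k, k 1J = 1J &
  forall a b, k (jmul a b) = jmul (k a) (k b)]].

(* Some g in GOmega with g(1) = x: it exists for x in Omega, the action being
   transitive, and dprime does not depend on which one is chosen. *)
Definition orbit_lift x : bop V := get [set g | GOmega g /\ g 1J = x].

Definition dprime x y : \bar R :=
  let g := orbit_lift x in let h := orbit_lift y in
  ereal_inf [set distG (bcomp g k.1) (bcomp h k.2) | k in AutV `*` AutV].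

End JBAlgebraTheory.

(* Main.v *)
Require Import Defs.
From HB Require Import structures.
From mathcomp Require Import all_boot all_order all_algebra.
From mathcomp Require Import all_classical all_reals all_analysis.
From mathcomp Require Import measurable_realfun ring lra complex.

Set Implicit Arguments.
Unset Strict Implicit.
Unset Printing Implicit Defensive.

Import Order.TTheory GRing.Theory Num.Theory.
Import numFieldNormedType.Exports.

Local Open Scope classical_set_scope.
Local Open Scope ring_scope.

(** Why the two distances agree. Write g for an element of the structure group
    and H for a tangent vector at g. The orbit map g |-> g(1) does not increase
    lengths: at the point g(1) the norm of a tangent vector v is |g^-1(v)|
    ([tnormO_GOmega]), and |(g^-1 H)(1)| <= |g^-1 H|. Hence the distance in the
    cone is at most the distance between orbit representatives
    ([distO_le_dprime]).

    Conversely, a path ga in the cone is lifted, up to an arbitrarily small error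
    in length, by gluing explicit short pieces. If g(1) = ga(u) and ga(b) is near
    ga(u), then g^-1(ga(b)) = (1 + w)^2 for a small w, and s |-> g U_(1 + s w)
    is a path in the structure group that lifts ga(b) at s = 1 and whose speed is
    2 |w| to first order, which is the length of the chord ([orbit_step]). No
    differential equation is solved: a Cousin argument ([interval_induction])
    glues these pieces, using only the one-sided derivatives of ga. The lift of a
    path from x to y ends at an element that sends 1 to y, hence that differs
    from the chosen representative of y by an element of the stabilizer of 1; it
    remains to know that the stabilizer consists of Jordan automorphisms
    ([unital_GOmega_Aut]).

    The Jordan theory behind this is developed from the axioms. Every element
    lies in a closed subalgebra whose multiplication operators commute
    ([calg_ca]); there U_(a b) = U_a U_b ([UopM]), and square roots and inverses
    near the unit are fixed points of contractions. Calling x positive when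
    |r - x| < r for some r > 0 gives at once an open convex cone; the axiom
    |x^2| <= |x^2 + y^2| shows that squares are in its closure ([jnneg_sq]) and
    that the norm is the order unit norm ([jnorm_le]). For positive q the
    operator U_q is positive ([Uop_nneg]): it is a product of n operators
    U_(1 + z) with z of order 1/n, and each is positive up to an error of order
    1/n^2. The cone coincides with the set of elements of positive spectrum
    ([OmegaP]), and factoring real polynomials yields the functional calculus
    needed for inverse square roots ([jsqrtV_spec]).

    That a unital order automorphism k is a Jordan automorphism follows from a
    Mazur-Ulam argument for the order distance on the cone. Inversion reverses
    the order ([jinv_anti]), so it is a point reflection at the unit for that
    distance, and Vaisala's reflection trick gives k(x^-1) = k(x)^-1
    ([unital_GOmega_jinv]). Squares are preserved as well, since p - p^2 is the
    inverse of p^-1 + (1 - p)^-1. *)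

(** * Linear identities in modules *)

Section Idealization.
Variables (R : comNzRingType) (V : lmodType R).

(** The square-zero extension of the scalars by the module is a commutative ring
    that contains the module; the ring tactic decides linear identities there. *)
Definition idealization : Type := (R * V)%type.

HB.instance Definition _ := GRing.Zmodule.copy idealization (R * V)%type.

Definition id_mul (a b : idealization) : idealization :=
  (a.1 * b.1, a.1 *: b.2 + b.1 *: a.2).

Lemma id_eq (a b : idealization) : a.1 = b.1 -> a.2 = b.2 -> a = b.
Proof. by case: a b => ? ? [? ?] /= -> ->. Qed.

Lemma id_mulA : associative id_mul.
Proof.
move=> a b c; apply: id_eq; rewrite /id_mul /= ?mulrA//.
by rewrite !scalerDr !scalerA addrA (mulrC c.1) (mulrC c.1).
Qed.
Lemma id_mulC : commutative id_mul.
Proof. by move=> a b; rewrite /id_mul mulrC addrC. Qed.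
Lemma id_mul1 : left_id ((1, 0) : idealization) id_mul.
Proof. by move=> [a v]; rewrite /id_mul /= mul1r scale1r scaler0 addr0. Qed.
Lemma id_mulD : left_distributive id_mul +%R.
Proof.
move=> a b c; apply: id_eq; rewrite /id_mul /= ?mulrDl//.
by rewrite scalerDl scalerDr addrACA.
Qed.
Lemma id_1neq0 : ((1, 0) : idealization) != 0.
Proof. by apply/eqP => -[/eqP]; rewrite oner_eq0. Qed.

HB.instance Definition _ := GRing.Zmodule_isComNzRing.Build idealization
  id_mulA id_mulC id_mul1 id_mulD id_1neq0.

Definition id_scal (a : R) : idealization := (a, 0).
Definition id_vec (v : V) : idealization := (0, v).

Lemma id_scal_zmod : zmod_morphism id_scal.
Proof. by move=> a b; apply: id_eq; rewrite /= ?subr0. Qed.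
HB.instance Definition _ := GRing.isZmodMorphism.Build R idealization id_scal
  id_scal_zmod.
Lemma id_scal_mul : monoid_morphism id_scal.
Proof.
split=> // a b; apply: id_eq => //=.
by rewrite !scaler0 addr0.
Qed.
HB.instance Definition _ := GRing.isMonoidMorphism.Build R idealization id_scal
  id_scal_mul.
Lemma id_vecD u v : id_vec (u + v) = id_vec u + id_vec v.
Proof. by apply: id_eq; rewrite /= ?addr0. Qed.
Lemma id_vecN u : id_vec (- u) = - id_vec u.
Proof. by apply: id_eq; rewrite /= ?oppr0. Qed.
Lemma id_vec0 : id_vec 0 = 0. Proof. by []. Qed.
Lemma id_vecZ a v : id_vec (a *: v) = id_scal a * id_vec v.
Proof. by apply: id_eq; rewrite /= ?mulr0// scale0r addr0. Qed.
Lemma id_vec_inj : injective id_vec.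
Proof. by move=> u v []. Qed.
End Idealization.

Ltac module :=
  apply: id_vec_inj; do ?rewrite !(id_vecD, id_vecN, id_vec0, id_vecZ); ring.

(** * The Jordan identity *)

Section JordanProduct.
Variables (R : realType) (V : jbAlgType R).
Implicit Types (x y z u v w a b c p : V) (s t r : R).
Local Notation "x ∘ y" := (jmul x y) (at level 40, left associativity).
Local Notation "1J" := (@jone R V).

Lemma jmulDl x y z : (x + y) ∘ z = x ∘ z + y ∘ z.
Proof. by have := jmul_linear z 1 x y; rewrite /= !scale1r. Qed.
Lemma jmulZl t x z : (t *: x) ∘ z = t *: (x ∘ z).
Proof.
have L0 : (0 : V) ∘ z = 0.
  by apply: (addrI ((0:V) ∘ z)); rewrite -jmulDl !addr0.
by have := jmul_linear z t x 0; rewrite /= L0 !addr0.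
Qed.
Lemma jmulDr x y z : x ∘ (y + z) = x ∘ y + x ∘ z.
Proof. by rewrite !(jmulC x) jmulDl. Qed.
Lemma jmulZr t x z : x ∘ (t *: z) = t *: (x ∘ z).
Proof. by rewrite !(jmulC x) jmulZl. Qed.
Lemma jmulNl x y : (- x) ∘ y = - (x ∘ y).
Proof. by rewrite -scaleN1r jmulZl scaleN1r. Qed.
Lemma jmulNr x y : x ∘ (- y) = - (x ∘ y).
Proof. by rewrite -scaleN1r jmulZr scaleN1r. Qed.
Lemma jmul0l x : 0 ∘ x = 0.
Proof. by rewrite -(scale0r (0 : V)) jmulZl !scale0r. Qed.
Lemma jmul0r x : x ∘ 0 = 0.
Proof. by rewrite jmulC jmul0l. Qed.
Lemma jmulx1 x : x ∘ 1J = x.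
Proof. by rewrite jmulC jmul1x. Qed.

Definition jmulE :=
  (jmulDl, jmulDr, jmulZl, jmulZr, jmulNl, jmulNr, jmul0l, jmul0r, jmulx1,
   @jmul1x R V).

(** Trilinear in (x, z, w); the Jordan identity says that it vanishes on the
    diagonal. *)
Let T x z w y := (x ∘ z) ∘ (w ∘ y) - w ∘ ((x ∘ z) ∘ y).

Let T0 x y : T x x x y = 0.
Proof. by rewrite /T jordan_id subrr. Qed.

Let T1 x z y : T x x z y + 2 *: T x z x y = 0.
Proof.
have P : T (x + z) (x + z) (x + z) y = (T x x z y + 2 *: T x z x y) +
   (T z z x y + 2 *: T z x z y) + T x x x y + T z z z y.
  rewrite /T !jmulE (jmulC z x); module.
have N : T (x - z) (x - z) (x - z) y = - (T x x z y + 2 *: T x z x y) +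
   (T z z x y + 2 *: T z x z y) + T x x x y - T z z z y.
  rewrite /T !jmulE (jmulC z x); module.
have : 2 *: (T x x z y + 2 *: T x z x y) =
  T (x + z) (x + z) (x + z) y - T (x - z) (x - z) (x - z) y - 2 *: T z z z y.
  by rewrite P N; module.
rewrite !T0 scaler0 !subr0.
by move/eqP; rewrite scaler_eq0 pnatr_eq0 /= => /eqP.
Qed.

Let T2 x z w y : T x z w y + T x w z y + T z w x y = 0.
Proof.
have := T1 (x + z) w y.
have -> : T (x + z) (x + z) w y + 2 *: T (x + z) w (x + z) y =
  (T x x w y + 2 *: T x w x y) + (T z z w y + 2 *: T z w z y) +
  2 *: (T x z w y + T x w z y + T z w x y).
  by rewrite /T !jmulE (jmulC z x); module.
rewrite !T1 !add0r => /eqP; by rewrite scaler_eq0 pnatr_eq0 /= => /eqP.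
Qed.

(** Polarization of the Jordan identity at x + z and x - z, then at x + z again. *)
Lemma jordan_linearized x z w y :
  (x ∘ z) ∘ (w ∘ y) + (x ∘ w) ∘ (z ∘ y) + (z ∘ w) ∘ (x ∘ y) =
  w ∘ ((x ∘ z) ∘ y) + z ∘ ((x ∘ w) ∘ y) + x ∘ ((z ∘ w) ∘ y).
Proof.
apply/eqP; rewrite -subr_eq0 -[X in _ == X](T2 x z w y) /T; apply/eqP.
by rewrite (jmulC z w); module.
Qed.

(** The linearized identity, read with y as the vector acted upon: it reduces
    multiplication by a product of three factors to multiplications by the
    factors and their pairwise products. All commutation results below and the
    multiplicativity of the quadratic operators come from it. *)
Lemma jmul_triple x z w y : ((z ∘ x) ∘ w) ∘ y =
  (x ∘ w) ∘ (z ∘ y) + (z ∘ x) ∘ (w ∘ y) + (z ∘ w) ∘ (x ∘ y)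
  - x ∘ (w ∘ (z ∘ y)) - z ∘ (w ∘ (x ∘ y)).
Proof.
rewrite (jmulC (z ∘ x ∘ w) y) (jmulC z x) (jmulC w y) (jmulC (x ∘ w)).
rewrite (jmulC (z ∘ w)) (jmulC w (z ∘ y)) (jmulC w (x ∘ y)).
have /eqP := jordan_linearized x z y w; rewrite eq_sym -subr_eq0 => /eqP E.
by apply/eqP; rewrite -subr_eq0 -[X in _ == X]E; apply/eqP; module.
Qed.
End JordanProduct.

(** * Commutative subalgebras *)

Section CommutingSubalgebras.
Variables (R : realType) (V : jbAlgType R).
Implicit Types (x y z u v w a b c d p : V) (s t r : R) (A : set V).
Local Notation "x ∘ y" := (jmul x y) (at level 40, left associativity).
Local Notation "1J" := (@jone R V).

Definition opcomm a b := forall v, a ∘ (b ∘ v) = b ∘ (a ∘ v).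

Lemma opcomm1 a : opcomm a 1J.
Proof. by move=> v; rewrite !jmulE. Qed.

Lemma opcomm_sym a b : opcomm a b -> opcomm b a.
Proof. by move=> ab v; rewrite ab. Qed.

Lemma opcommD a b c : opcomm a b -> opcomm a c -> opcomm a (b + c).
Proof. by move=> ab ac v; rewrite !jmulE ab ac. Qed.

Lemma opcommZ t a b : opcomm a b -> opcomm a (t *: b).
Proof. by move=> ab v; rewrite !jmulE ab. Qed.

Lemma opcomm_triple d x z w : opcomm d x -> opcomm d z -> opcomm d w ->
  opcomm d (x ∘ w) -> opcomm d (z ∘ x) -> opcomm d (z ∘ w) ->
  opcomm d ((z ∘ x) ∘ w).
Proof.
move=> dx dz dw dxw dzx dzw v; rewrite !jmul_triple !jmulE.
by rewrite !(dx, dz, dw, dxw, dzx, dzw).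
Qed.

Lemma opcomm_sq p : opcomm p (p ∘ p).
Proof. by move=> v; rewrite jordan_id. Qed.

(** Multiplication by p^(n+2) = (p p^n) p is a polynomial in the multiplications
    by p, p^2, p^n and p^(n+1). *)
Lemma opcomm_jpow d p n : opcomm d p -> opcomm d (p ∘ p) ->
  opcomm d (jpow p n).
Proof.
move=> dp dpp; suff [] : opcomm d (jpow p n) /\ opcomm d (jpow p n.+1) by [].
elim: n => [|n [IH1 IH2]].
  by split; [exact: opcomm1|rewrite /jpow /= jmulx1].
split=> //; have -> : jpow p n.+2 = (p ∘ jpow p n) ∘ p.
  by rewrite [RHS]jmulC.
by apply: opcomm_triple => //; rewrite jmulC.
Qed.

Lemma jhornerE n (P : {poly R}) p : (size P <= n)%N ->
  jhorner P p = \sum_(i < n) P`_i *: jpow p i.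
Proof.
move=> Pn; rewrite /jhorner (big_ord_widen n (fun i => P`_i *: jpow p i))//.
rewrite big_mkcond; apply: eq_bigr => i _; case: ifPn => //.
by rewrite -leqNgt => /(nth_default 0) ->; rewrite scale0r.
Qed.

Lemma jhornerD (P Q : {poly R}) p : jhorner (P + Q) p = jhorner P p + jhorner Q p.
Proof.
pose n := maxn (size P) (size Q).
rewrite (@jhornerE n (P + Q)) ?size_polyD// (@jhornerE n P) ?leq_maxl//.
rewrite (@jhornerE n Q) ?leq_maxr// -big_split; apply: eq_bigr => i _ /=.
by rewrite coefD scalerDl.
Qed.

Lemma jhornerZ t (P : {poly R}) p : jhorner (t *: P) p = t *: jhorner P p.
Proof.
rewrite (@jhornerE (size P)) ?size_scale_leq// scaler_sumr.
by apply: eq_bigr => i _; rewrite coefZ scalerA.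
Qed.

Lemma jhornerC t p : jhorner t%:P p = t *: 1J.
Proof. by rewrite (@jhornerE 1) ?size_polyC ?leq_b1// big_ord1 coefC. Qed.

Lemma jhornerMX (P : {poly R}) p : jhorner (P * 'X) p = p ∘ jhorner P p.
Proof.
rewrite (@jhornerE (size P).+1); last first.
  by rewrite (leq_trans (size_polyMleq _ _))// size_polyX addn2.
rewrite big_ord_recl coefMX /= scale0r add0r /jhorner.
rewrite (big_morph _ (jmulDr p) (jmul0r p)); apply: eq_bigr => i _.
by rewrite coefMX /= jmulZr.
Qed.

Lemma jhornerX p : jhorner 'X p = p.
Proof. by rewrite -['X]mul1r jhornerMX -polyC1 jhornerC scale1r jmulx1. Qed.

Lemma opcomm_jhorner d (P : {poly R}) p : opcomm d p -> opcomm d (p ∘ p) ->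
  opcomm d (jhorner P p).
Proof.
move=> dp dpp; rewrite /jhorner; elim/big_ind : _ => [|a b|i _].
- by move=> v; rewrite !jmulE.
- exact: opcommD.
- exact/opcommZ/opcomm_jpow.
Qed.

Lemma opcomm_jhorner2 (P Q : {poly R}) p : opcomm (jhorner P p) (jhorner Q p).
Proof.
by apply: opcomm_jhorner; apply: opcomm_sym; apply: opcomm_jhorner => //;
  [exact: opcomm_sq|exact/opcomm_sym/opcomm_sq].
Qed.

(** Power associativity is a consequence of operator commutativity: p^n is the
    n-th power of multiplication by p applied to the unit. *)
Lemma jhornerM (P Q : {poly R}) p : jhorner (P * Q) p = jhorner P p ∘ jhorner Q p.
Proof.
elim/poly_ind: P => [|P c IH].
  by rewrite mul0r -polyC0 jhornerC scale0r jmul0l.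
rewrite mulrDl -mulrA -commr_polyX mulrA jhornerD jhornerMX IH mul_polyC.
rewrite jhornerZ jhornerD jhornerMX jhornerC !jmulE; congr (_ + _).
rewrite (jmulC (p ∘ _)) (jmulC (jhorner P p) (jhorner Q p)).
by have := opcomm_jhorner2 'X Q p; rewrite jhornerX => ->.
Qed.

(** Closed subalgebras whose multiplication operators commute on the whole
    algebra, not only on the subalgebra. They are associative, and every
    element lies in one; all computations with functions of a single element
    take place there. *)
Record commutative_subalgebra A : Prop := CommutativeSubalgebra {
  ca1 : A 1J;
  caD : forall a b, A a -> A b -> A (a + b);
  caZ : forall t a, A a -> A (t *: a);
  caM : forall a b, A a -> A b -> A (a ∘ b);
  ca_opcomm : forall a b, A a -> A b -> opcomm a b;
  ca_closed : closed A }.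

Definition jpoly p : set V := range (fun P : {poly R} => jhorner P p).

Definition calg p : set V := closure (jpoly p).

Lemma closureP A a : closure A a <-> forall e : R, 0 < e ->
  exists2 b, A b & `|b - a| <= e.
Proof.
split=> [Aa e e0|Aa B].
  have /Aa [b [Ab]] : nbhs a (ball a e) by exact: nbhsx_ballx.
  by rewrite -ball_normE /= distrC => /ltW ?; exists b.
rewrite -nbhs_ballE => -[e /= e0 eB].
have [b Ab be] := Aa (e / 2) (divr_gt0 e0 (ltr0n _ 2)).
exists b; split => //; apply: eB; rewrite -ball_normE /= distrC.
by rewrite (le_lt_trans be)// ltr_pdivrMr// ltr_pMr// ltr1n.
Qed.

Lemma jmul_continuous : continuous (fun q : V * V => q.1 ∘ q.2).
Proof.
move=> [a b] /=; apply/cvgrPdist_le => /= e e0.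
pose M := `|a| + `|b| + 1; have M0 : 0 < M.
  by rewrite ltr_wpDl// addr_ge0.
pose d := Num.min 1 (e / M); have d0 : 0 < d by rewrite lt_min ltr01 divr_gt0.
near=> q; have [q1 q2] : `|a - q.1| <= d /\ `|b - q.2| <= d.
  by near: q; exists (ball a d, ball b d);
    [split; exact: nbhsx_ballx|move=> q []; rewrite -!ball_normE /= => /ltW ? /ltW].
have -> : a ∘ b - q.1 ∘ q.2 = (a - q.1) ∘ b + a ∘ (b - q.2) - (a - q.1) ∘ (b - q.2).
  by rewrite !jmulE; module.
have := ler_normB ((a - q.1) ∘ b + a ∘ (b - q.2)) ((a - q.1) ∘ (b - q.2)).
move/le_trans; apply.
have H1 := jnormM (a - q.1) b; have H2 := jnormM a (b - q.2).
have H3 := jnormM (a - q.1) (b - q.2).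
have H4 := ler_normD ((a - q.1) ∘ b) (a ∘ (b - q.2)).
have dM : d * M <= e by rewrite -ler_pdivlMr// ge_min lexx orbT.
have d1 : d <= 1 by rewrite ge_min lexx.
have E1 : `|a - q.1| * `|b| <= d * `|b| by rewrite ler_wpM2r.
have E2 : `|a| * `|b - q.2| <= `|a| * d by rewrite ler_wpM2l.
have E3 : `|a - q.1| * `|b - q.2| <= d * 1.
  by rewrite ler_pM// (le_trans q2).
move: dM; rewrite /M; lra.
Unshelve. all: end_near. Qed.

Lemma cvg_jmul (T : Type) (F : set_system T) (FF : Filter F) (f g : T -> V) a b :
  f @ F --> a -> g @ F --> b -> f x ∘ g x @[x --> F] --> a ∘ b.
Proof.
move=> fa gb; apply: (@continuous2_cvg _ _ _ _ F FF f g (fun x y => x ∘ y) a b) => //.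
exact: (@jmul_continuous (a, b)).
Qed.

Lemma closed_opcomm b : closed [set a | opcomm a b].
Proof.
have -> : [set a | opcomm a b] =
  \bigcap_(v in setT) ((fun a => a ∘ (b ∘ v) - b ∘ (a ∘ v)) @^-1` [set 0]).
  apply/seteqP; split=> [a ab v _|a ab v].
    by rewrite /= ab subrr.
  by apply/eqP; rewrite -subr_eq0; apply/eqP; exact: ab.
apply: closed_bigI => v _; apply: preimage_closed.
  move=> a _; apply: cvgB; do ?apply: cvg_jmul; do ?exact: cvg_cst; exact: cvg_id.
exact/accessible_closed_set1/hausdorff_accessible/norm_hausdorff.
Qed.

(** Commutation extends from polynomials to limits, one factor at a time. *)
Lemma calg_ca p : commutative_subalgebra (calg p).
Proof.
have sub P : calg p (jhorner P p) by apply: subset_closure; exists P.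
split; last exact: closed_closure.
- by rewrite -[1J]scale1r -(jhornerC 1 p).
- move=> a b /closureP ha /closureP hb; apply/closureP => e e0.
  have e2 : 0 < e / 2 by rewrite divr_gt0.
  have [_ [P _ <-] Pa] := ha _ e2; have [_ [Q _ <-] Qb] := hb _ e2.
  exists (jhorner (P + Q) p); first by exists (P + Q).
  rewrite jhornerD opprD addrACA (le_trans (ler_normD _ _))//.
  by rewrite (splitr e) lerD.
- move=> t a /closureP ha; apply/closureP => e e0.
  have e2 : 0 < e / (`|t| + 1) by rewrite divr_gt0// ltr_wpDl.
  have [_ [P _ <-] Pa] := ha _ e2.
  exists (jhorner (t *: P) p); first by exists (t *: P).
  rewrite jhornerZ -scalerBr normrZ (le_trans (ler_wpM2l _ Pa))//.
  by rewrite mulrCA ger_pMr// ler_pdivrMr ?ltr_wpDl// mul1r lerDl.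
- move=> a b ha hb B; have /= := @jmul_continuous (a, b) B.
  move=> h /h[[/= B1 B2] [B1a B2b] B12].
  have [_ [[P _ <-] PB1]] := ha _ B1a; have [_ [[Q _ <-] QB2]] := hb _ B2b.
  by exists (jhorner (P * Q) p); split; [exists (P * Q)|rewrite jhornerM;
    exact: (B12 (_, _))].
- have H1 Q a : calg p a -> opcomm a (jhorner Q p).
    move=> Ca; apply: (@closed_opcomm (jhorner Q p)); move: a Ca.
    by apply: closureS => _ [P _ <-]; exact: opcomm_jhorner2.
  move=> a b Ca Cb; apply: opcomm_sym; apply: (@closed_opcomm a).
  move: b Cb; apply: closureS => _ [P _ <-].
  by apply: opcomm_sym; exact: H1.
Qed.

Lemma calg_id p : calg p p.
Proof. by apply: subset_closure; exists 'X => //; rewrite jhornerX. Qed.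

End CommutingSubalgebras.
Arguments calg_id {R V} p.
Arguments calg_ca {R V} p.

Section SubalgebraArithmetic.
Variables (R : realType) (V : jbAlgType R).
Implicit Types (x y z u v w a b c d p : V) (s t r : R).
Local Notation "x ∘ y" := (jmul x y) (at level 40, left associativity).
Local Notation "1J" := (@jone R V).

Variable A : set V.
Hypothesis caA : commutative_subalgebra A.

Lemma ca_assoc a b c : A a -> A b -> A c -> (a ∘ b) ∘ c = a ∘ (b ∘ c).
Proof.
by move=> Aa Ab Ac; rewrite jmulC (ca_opcomm caA Ac Aa) (jmulC c).
Qed.

Lemma ca_mulACA a b c d : A a -> A b -> A c -> A d ->
  (a ∘ b) ∘ (c ∘ d) = (a ∘ c) ∘ (b ∘ d).
Proof.
move=> Aa Ab Ac Ad; rewrite !ca_assoc//; do ?exact: caM.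
by rewrite (ca_opcomm caA Ab Ac).
Qed.

Lemma ca0 : A 0.
Proof. by rewrite -(scale0r 1J); apply: caZ => //; exact: ca1. Qed.

Lemma caN a : A a -> A (- a).
Proof. by move=> Aa; rewrite -scaleN1r; exact: caZ. Qed.

Lemma caB a b : A a -> A b -> A (a - b).
Proof. by move=> Aa Ab; apply: caD => //; exact: caN. Qed.

Lemma ca_scal t : A (t *: 1J).
Proof. by apply: caZ => //; exact: ca1. Qed.

(** Comparing the two expansions of the multiplication operator of the square
    of a product that come from its factorizations (a^2 b) b and (a b) (a b)
    gives the relation needed for multiplicativity. *)
Lemma UopM a b v : A a -> A b -> Uop (a ∘ b) v = Uop a (Uop b v).
Proof.
move=> Aa Ab; set c := a ∘ b; set p := a ∘ a; set q := b ∘ b.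
have [Ac Ap Aq] : [/\ A c, A p & A q] by split; exact: caM.
have C := ca_opcomm caA.
have N := (C _ _ Ab Aa, C _ _ Ab Aq, C _ _ Aa Aq, C _ _ Ab Ap, C _ _ Aa Ap,
  C _ _ Aq Ap, C _ _ Ab Ac, C _ _ Aa Ac, C _ _ Aq Ac, C _ _ Ap Ac).
have X1 y : (p ∘ b) ∘ y =
  2 *: (c ∘ (a ∘ y)) + p ∘ (b ∘ y) - 2 *: (a ∘ (a ∘ (b ∘ y))).
  by rewrite jmul_triple -/c -/p !N; module.
have X2 y : (a ∘ q) ∘ y =
  2 *: (c ∘ (b ∘ y)) + q ∘ (a ∘ y) - 2 *: (a ∘ (b ∘ (b ∘ y))).
  by rewrite jmulC (jmulC a) (jmulC y) jmul_triple (jmulC b a) -/c -/q !N; module.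
have E1 : (c ∘ c) ∘ v = q ∘ (p ∘ v) + 2 *: ((p ∘ b) ∘ (b ∘ v))
   - 2 *: (p ∘ (b ∘ (b ∘ v))).
  have -> : c ∘ c = (p ∘ b) ∘ b.
    by rewrite /c ca_mulACA// -/p ca_assoc.
  by rewrite jmul_triple -/q !N; module.
have E2 : (c ∘ c) ∘ v = (a ∘ q) ∘ (a ∘ v) + c ∘ (c ∘ v) + (p ∘ b) ∘ (b ∘ v)
   - 2 *: (c ∘ (a ∘ (b ∘ v))).
  rewrite {1}/c jmul_triple -/c.
  have -> : b ∘ c = a ∘ q by rewrite /c /q C.
  have -> : a ∘ c = p ∘ b by rewrite /c /p ca_assoc.
  by rewrite !N; module.
rewrite X2 X1 !N in E2; rewrite X1 !N in E1.
have -> : Uop c v = 2 *: (c ∘ (c ∘ v)) - 2 *: ((c ∘ c) ∘ v) + (c ∘ c) ∘ v.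
  by rewrite /Uop; module.
rewrite {1}E2 E1 /Uop -/p -/q !jmulE !N; module.
Qed.

End SubalgebraArithmetic.

Section Contractions.
Variables (R : realType) (V : completeNormedModType R).

(** Square roots and inverses will be found as fixed points inside a closed
    subalgebra; the bound on the fixed point is part of what is needed. *)
Lemma fixed_point_in_ball (A : set V) (f : V -> V) (M q : R) :
  closed A -> A 0 -> 0 <= M -> 0 <= q < 1 ->
  (forall v, A v -> `|v| <= M -> A (f v) /\ `|f v| <= M) ->
  (forall u v, A u -> A v -> `|u| <= M -> `|v| <= M ->
     `|f u - f v| <= q * `|u - v|) ->
  exists v, [/\ A v, `|v| <= M & v = f v].
Proof.
move=> clA A0 M0 /andP[q0 q1] fA fq.
pose U : set V := A `&` [set v | `|v| <= M].
have clU : closed U.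
  apply: closedI => //.
  apply: (@preimage_closed _ _ (fun v : V => `|v|) [set x : R | x <= M]).
    by move=> ? _; exact: norm_continuous.
  exact: closed_le.
have fU : set_fun U U f by move=> x [Ax xM]; exact: fA.
have ctr : is_contraction (mkfun fU).
  exists (NngNum q0); split=> //= -[x y] [[/= ? ?] [/= ? ?]]; exact: fq.
have [|p [Ap pM] pf] := banach_fixed_point ctr clU; last by exists p.
by exists 0; split=> //=; rewrite normr0.
Qed.
End Contractions.

(** * The cone and the order unit norm *)

Section OrderUnitCone.
Variables (R : realType) (V : jbAlgType R).
Implicit Types (x y z u v w a b c d p : V) (s t r e : R) (A : set V).
Local Notation "x ∘ y" := (jmul x y) (at level 40, left associativity).
Local Notation "1J" := (@jone R V).

Lemma jone_norm_le1 : `|1J| <= 1.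
Proof.
have := jnorm_sqr 1J; rewrite jmul1x => E; rewrite leNgt; apply/negP => lt1.
suff : `|1J| < `|1J| ^+ 2 by rewrite -E ltxx.
by rewrite expr2 ltr_pMr// (lt_trans ltr01 lt1).
Qed.

Lemma scal_norm_le t : 0 <= t -> `|t *: 1J| <= t.
Proof.
by move=> t0; rewrite normrZ ger0_norm// ler_piMr// jone_norm_le1.
Qed.

(** The open cone, described by the norm alone so that it is visibly convex;
    it turns out to consist of the elements with positive spectrum. *)
Definition jpos x := exists2 r : R, 0 < r & `|r *: 1J - x| < r.

(** The closed cone; x <= y will be expressed by jnneg (y - x). *)
Definition jnneg x := forall e : R, 0 < e -> jpos (x + e *: 1J).

Lemma jpos_ball x r : `|x| < r -> jpos (r *: 1J + x).
Proof.
move=> xr; exists r; first by rewrite (le_lt_trans _ xr).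
by rewrite opprD addrA subrr add0r normrN.
Qed.

Lemma jpos_scal e : 0 < e -> jpos (e *: 1J).
Proof. by move=> e0; rewrite -[e *: _]addr0; apply: jpos_ball; rewrite normr0. Qed.

Lemma jposD x y : jpos x -> jpos y -> jpos (x + y).
Proof.
move=> [r r0 rx] [s s0 sy]; exists (r + s); first exact: addr_gt0.
have -> : (r + s) *: 1J - (x + y) = (r *: 1J - x) + (s *: 1J - y) by module.
by rewrite (le_lt_trans (ler_normD _ _))// ltrD.
Qed.

Lemma jposZ t x : 0 < t -> jpos x -> jpos (t *: x).
Proof.
move=> t0 [r r0 rx]; exists (t * r); first exact: mulr_gt0.
by rewrite -scalerA -scalerBr normrZ gtr0_norm// ltr_pM2l.
Qed.

Lemma jpos_shrink x : jpos x -> exists2 e : R, 0 < e & jpos (x - e *: 1J).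
Proof.
move=> [r r0 rx]; pose e := (r - `|r *: 1J - x|) / 2.
have e0 : 0 < e by rewrite divr_gt0// subr_gt0.
exists e => //; exists r => //.
have -> : r *: 1J - (x - e *: 1J) = (r *: 1J - x) + e *: 1J by module.
rewrite (le_lt_trans (ler_normD _ _))//.
by have := scal_norm_le (ltW e0); rewrite /e; move: rx; lra.
Qed.

Lemma jpos_nneg x : jpos x -> jnneg x.
Proof. by move=> x0 e e0; apply: jposD => //; exact: jpos_scal. Qed.

Lemma jnneg_posD x y : jnneg x -> jpos y -> jpos (x + y).
Proof.
move=> x0 /jpos_shrink[e e0 y0].
have -> : x + y = (x + e *: 1J) + (y - e *: 1J) by module.
by apply: jposD => //; exact: x0.
Qed.

Lemma jnnegD x y : jnneg x -> jnneg y -> jnneg (x + y).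
Proof. by move=> x0 y0 e e0; rewrite -addrA; apply: jnneg_posD => //; exact: y0. Qed.

Lemma jnneg0 : jnneg 0.
Proof. by move=> e e0; rewrite add0r; exact: jpos_scal. Qed.

Lemma jnnegZ t x : 0 <= t -> jnneg x -> jnneg (t *: x).
Proof.
rewrite le_eqVlt => /predU1P[<- _|t0 x0]; first by rewrite scale0r; exact: jnneg0.
move=> e e0; have -> : t *: x + e *: 1J = t *: (x + (e / t) *: 1J).
  by rewrite scalerDr scalerA mulrCA divff ?gt_eqF// mulr1.
by apply: jposZ => //; apply: x0; exact: divr_gt0.
Qed.

Lemma jnneg_closed x : (forall e, 0 < e -> jnneg (x + e *: 1J)) -> jnneg x.
Proof.
move=> x0 e e0; have e2 : 0 < e / 2 by rewrite divr_gt0.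
have := x0 _ e2 _ e2; rewrite -addrA -scalerDl -splitr; exact.
Qed.

(** The unit dominates every element, so the perturbation e y is absorbed by a
    multiple of the unit that tends to 0 with e. *)
Lemma jnneg_arch x y : (forall e, 0 < e -> jnneg (x + e *: y)) ->
  jnneg x.
Proof.
move=> x0; apply: jnneg_closed => e e0.
pose d := e / (`|y| + 1); have y1 : 0 < `|y| + 1 by rewrite ltr_wpDl.
have d0 : 0 < d by rewrite divr_gt0.
have -> : x + e *: 1J = (x + d *: y) + (e *: 1J + (- d *: y)).
  by rewrite scaleNr; module.
apply: jnnegD; first exact: x0.
apply/jpos_nneg/jpos_ball; rewrite normrZ normrN gtr0_norm// /d.
by rewrite mulrAC ltr_pdivrMr// ltr_pM2l// ltrDl.
Qed.

Lemma jnneg_ballD x r : `|x| <= r -> jnneg (r *: 1J + x).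
Proof.
move=> xr e e0; rewrite addrAC -scalerDl; apply: jpos_ball.
by rewrite (le_lt_trans xr)// ltrDl.
Qed.

Lemma jnneg_ballB x r : `|x| <= r -> jnneg (r *: 1J - x).
Proof. by move=> xr; apply: jnneg_ballD; rewrite normrN. Qed.

Lemma jnneg_scal e : 0 <= e -> jnneg (e *: 1J).
Proof.
move=> e0; apply: jnnegZ => //; apply: jpos_nneg.
by rewrite -[1J]scale1r; exact: jpos_scal.
Qed.

(** Square roots near the unit: writing the root of 1 - u as 1 - w, the element
    w is a fixed point of w |-> (u + w^2) / 2, which contracts the ball of
    radius |u|. *)
Lemma sqrt_near1 A u : commutative_subalgebra A -> A u -> `|u| < 1 ->
  exists w, [/\ A w, `|w| <= `|u|, 2 *: w = u + w ∘ w &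
             (1J - w) ∘ (1J - w) = 1J - u].
Proof.
move=> cA Au u1.
have half0 : (0 : R) <= 2^-1 by rewrite invr_ge0.
have [|x Ax xu|x y Ax Ay xu yu|w [Aw wu wE]] :=
    @fixed_point_in_ball R V A (fun w => 2^-1 *: (u + w ∘ w)) `|u| `|u|
    (ca_closed cA) (ca0 cA) (normr_ge0 u).
- by rewrite normr_ge0.
- split.
    by apply: (caZ cA); apply: (caD cA) => //; exact: (caM cA).
  rewrite normrZ ger0_norm//.
  have := ler_normD u (x ∘ x); have := jnormM x x.
  have : `|x| * `|x| <= `|u| * 1 by apply: ler_pM => //; rewrite (le_trans xu)// ltW.
  lra.
- rewrite -scalerBr normrZ ger0_norm//.
  have -> : u + x ∘ x - (u + y ∘ y) = (x - y) ∘ (x + y).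
    by rewrite !jmulE (jmulC y x); module.
  have := jnormM (x - y) (x + y); have := ler_normD x y.
  have : `|x - y| * `|x + y| <= `|x - y| * (2 * `|u|).
    by rewrite ler_wpM2l// (le_trans (ler_normD _ _))//; move: xu yu; lra.
  lra.
have wE2 : 2 *: w = u + w ∘ w.
  by rewrite {1}wE scalerA divff ?scale1r// pnatr_eq0.
exists w; split => //.
rewrite !jmulE; have -> : u = 2 *: w - w ∘ w by rewrite wE2; module.
by module.
Qed.

(** Neumann series, in fixed point form. *)
Lemma inv_near1 A u : commutative_subalgebra A -> A u -> `|u| < 1 ->
  exists y, [/\ A y, `|y| <= (1 - `|u|)^-1 & (1J - u) ∘ y = 1J].
Proof.
move=> cA Au u1; have u1' : 0 < 1 - `|u| by rewrite subr_gt0.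
have [||x Ax xu|x y Ax Ay xu yu|w [Aw wu wE]] :=
    @fixed_point_in_ball R V A (fun y => 1J + u ∘ y) (1 - `|u|)^-1 `|u|
    (ca_closed cA) (ca0 cA).
- by rewrite invr_ge0 ltW.
- by rewrite normr_ge0.
- split.
    by apply: (caD cA); [exact: (ca1 cA)|exact: (caM cA)].
  rewrite (le_trans (ler_normD _ _))//.
  have := jnormM u x; have := jone_norm_le1.
  have : `|u| * `|x| <= `|u| * (1 - `|u|)^-1 by rewrite ler_wpM2l.
  have : (1 - `|u|) * (1 - `|u|)^-1 = 1 by rewrite divff// gt_eqF.
  rewrite mulrBl mul1r; lra.
- have -> : 1J + u ∘ x - (1J + u ∘ y) = u ∘ (x - y) by rewrite !jmulE; module.
  exact: jnormM.
by exists w; split => //; rewrite !jmulE {1}wE; module.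
Qed.

Lemma jsqrt_exists A x : commutative_subalgebra A -> A x -> jpos x ->
  exists s : V, [/\ A s, jpos s & s ∘ s = x].
Proof.
move=> cA Ax [r r0 rx].
have Au : A (1J - r^-1 *: x) by apply: (caB cA); [exact: (ca1 cA)|exact: (caZ cA)].
have u1 : `|1J - r^-1 *: x| < 1.
  have -> : 1J - r^-1 *: x = r^-1 *: (r *: 1J - x).
    by rewrite scalerBr scalerA mulVf ?scale1r// gt_eqF.
  by rewrite normrZ gtr0_norm ?invr_gt0// ltr_pdivrMl// mulr1.
have [w [Aw wu _ ww]] := sqrt_near1 cA Au u1.
exists (Num.sqrt r *: (1J - w)); split.
- by apply: (caZ cA); apply: (caB cA) => //; exact: (ca1 cA).
- apply: jposZ; first by rewrite sqrtr_gt0.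
  rewrite -[X in X - w]scale1r; apply: jpos_ball.
  by rewrite normrN (le_lt_trans wu).
rewrite jmulZl jmulZr scalerA -expr2 sqr_sqrtr ?ltW// ww.
by rewrite opprB addrC subrK scalerA divff ?scale1r// gt_eqF.
Qed.

(** For |x| < 1 the element 1 - x^2 is a square y^2, and the axiom
    |y^2| <= |y^2 + x^2| bounds its norm by 1. *)
Lemma jnneg_sq x : jnneg (x ∘ x).
Proof.
have [cA Ax] := (calg_ca x, calg_id x).
pose t : R := `|x| + 1; have t0 : 0 < t by rewrite ltr_wpDl.
pose z := t^-1 *: x; have z1 : `|z| < 1.
  by rewrite normrZ gtr0_norm ?invr_gt0// ltr_pdivrMl// mulr1 ltrDl.
suff zz : jnneg (z ∘ z).
  have -> : x ∘ x = (t * t) *: (z ∘ z).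
    rewrite jmulZl jmulZr !scalerA; have -> : t * t * t^-1 * t^-1 = 1.
      by field; rewrite gt_eqF.
    by rewrite scale1r.
  by apply: jnnegZ => //; rewrite mulr_ge0// ltW.
have Az : calg x z by exact: (caZ cA).
have zz1 : `|z ∘ z| < 1 by rewrite jnorm_sqr expr_lt1.
have [w [_ _ _ ww]] := sqrt_near1 cA (caM cA Az Az) zz1.
move=> e e0; exists (1 + e); first by rewrite addr_gt0.
have -> : (1 + e) *: 1J - (z ∘ z + e *: 1J) = (1J - w) ∘ (1J - w).
  by rewrite ww; module.
rewrite (le_lt_trans (jnorm_sqrD _ z))// ww subrK.
by rewrite (le_lt_trans jone_norm_le1)// ltrDl.
Qed.

(** In a commutative subalgebra s^2 t^2 = (s t)^2. *)
Lemma jnneg_mul A a b : commutative_subalgebra A -> A a -> A b ->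
  jnneg a -> jnneg b -> jnneg (a ∘ b).
Proof.
move=> cA Aa Ab a0 b0.
have eP e : 0 < e -> jnneg ((a + e *: 1J) ∘ (b + e *: 1J)).
  move=> e0; have Ae := ca_scal cA e.
  have [s [As _ ss]] := jsqrt_exists cA (caD cA Aa Ae) (a0 _ e0).
  have [t [At _ tt]] := jsqrt_exists cA (caD cA Ab Ae) (b0 _ e0).
  by rewrite -ss -tt (ca_mulACA cA)//; exact: jnneg_sq.
pose M := `|a| + `|b| + 1.
have M0 : 0 < M by rewrite ltr_wpDl// addr_ge0.
apply: (@jnneg_arch _ (M *: 1J)) => e e0.
pose d := Num.min e 1; have d0 : 0 < d by rewrite lt_min e0 ltr01.
have -> : a ∘ b + e *: (M *: 1J) = (a + d *: 1J) ∘ (b + d *: 1J) +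
   ((e * M) *: 1J - d *: (a + b + d *: 1J)).
  by rewrite !jmulE; module.
apply: jnnegD; first exact: eP.
apply: jnneg_ballB; rewrite normrZ gtr0_norm// ler_pM ?(ltW d0)//.
  by rewrite ge_min lexx.
rewrite (le_trans (ler_normD _ _))// lerD// ?ler_normD//.
by rewrite (le_trans (scal_norm_le (ltW d0)))// ge_min lexx orbT.
Qed.

(** The product r^2 - v^2 of r + v and r - v is positive in the algebra of v,
    hence is a square c^2 after adding a small multiple of the unit, and
    |v^2| <= |v^2 + c^2|. *)
Lemma jnorm_le r v : 0 <= r -> jnneg (r *: 1J + v) -> jnneg (r *: 1J - v) ->
  `|v| <= r.
Proof.
move=> r0 vD vB; have [cA Av] := (calg_ca v, calg_id v).
have Ar := ca_scal cA r.
have := jnneg_mul cA (caD cA Ar Av) (caB cA Ar Av) vD vB.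
have -> : (r *: 1J + v) ∘ (r *: 1J - v) = (r ^+ 2) *: 1J - v ∘ v.
  by rewrite !jmulE; module.
move=> rv; rewrite -(@ler_pXn2r _ 2) ?nnegrE// -jnorm_sqr.
apply/ler_addgt0Pr => e e0.
have [s [As _ ss]] := jsqrt_exists cA
  (caD cA (caB cA (ca_scal cA (r ^+ 2)) (caM cA Av Av)) (ca_scal cA e)) (rv e e0).
rewrite (le_trans (jnorm_sqrD _ s))// ss.
have -> : v ∘ v + (r ^+ 2 *: 1J - v ∘ v + e *: 1J) = (r ^+ 2 + e) *: 1J by module.
by apply: scal_norm_le; rewrite addr_ge0 ?sqr_ge0// ltW.
Qed.

Lemma jnneg_anti v : jnneg v -> jnneg (- v) -> v = 0.
Proof.
move=> v0 v0'; apply/eqP; rewrite -normr_le0; apply: jnorm_le => //.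
  by rewrite scale0r add0r.
by rewrite scale0r add0r.
Qed.

(** The inverse is a Neumann series; it is bounded below because x is bounded
    above. *)
Lemma jpos_inv A x : commutative_subalgebra A -> A x -> jpos x ->
  exists y, [/\ A y, jpos y & x ∘ y = 1J].
Proof.
move=> cA Ax x0; have [r r0 rx] := x0.
have Au : A (1J - r^-1 *: x) by apply: (caB cA); [exact: (ca1 cA)|exact: (caZ cA)].
have u1 : `|1J - r^-1 *: x| < 1.
  have -> : 1J - r^-1 *: x = r^-1 *: (r *: 1J - x).
    by rewrite scalerBr scalerA mulVf ?scale1r// gt_eqF.
  by rewrite normrZ gtr0_norm ?invr_gt0// ltr_pdivrMl// mulr1.
have [y' [Ay' _ xy']] := inv_near1 cA Au u1.
pose y := r^-1 *: y'; have Ay : A y by exact: (caZ cA).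
have xy : x ∘ y = 1J.
  by rewrite -xy' /y opprB addrC subrK !jmulE.
move: Ay xy; move: (y) => {xy' Ay' Au u1 rx r0} {}y Ay xy.
have y0 : jnneg y.
  have -> : y = x ∘ (y ∘ y) by rewrite -(ca_assoc cA)// xy jmul1x.
  apply: (jnneg_mul cA) => //; [exact: (caM cA)|exact: jpos_nneg|exact: jnneg_sq].
exists y; split => //.
pose M := `|x| + 1; have M0 : 0 < M by rewrite ltr_wpDl.
have : jnneg ((M *: 1J - x) ∘ y).
  apply: (jnneg_mul cA) => //; first by apply: (caB cA) => //; exact: (ca_scal cA).
  by apply: jnneg_ballB; rewrite lerDl.
rewrite !jmulE xy => yM.
have -> : y = M^-1 *: (M *: y - 1J) + M^-1 *: 1J.
  by rewrite scalerBr scalerA mulVf ?scale1r ?subrK// gt_eqF.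
apply: jnneg_posD; first by apply: jnnegZ => //; rewrite invr_ge0 ltW.
by apply: jpos_scal; rewrite invr_gt0.
Qed.

(** A bound M on the inverse is a lower bound 1 / M on x. *)
Lemma jnneg_inv_pos A x y : commutative_subalgebra A -> A x -> A y ->
  jnneg x -> x ∘ y = 1J -> jpos x.
Proof.
move=> cA Ax Ay x0 xy.
have y0 : jnneg y.
  have -> : y = x ∘ (y ∘ y) by rewrite -(ca_assoc cA)// xy jmul1x.
  apply: (jnneg_mul cA) => //; [exact: (caM cA)|exact: jnneg_sq].
pose M := `|y| + 1; have M0 : 0 < M by rewrite ltr_wpDl.
have : jnneg (x ∘ (M *: 1J - y)).
  apply: (jnneg_mul cA) => //; first by apply: (caB cA) => //; exact: (ca_scal cA).
  by apply: jnneg_ballB; rewrite lerDl.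
rewrite !jmulE xy => yM.
have -> : x = M^-1 *: (M *: x - 1J) + M^-1 *: 1J.
  by rewrite scalerBr scalerA mulVf ?scale1r ?subrK// gt_eqF.
apply: jnneg_posD; first by apply: jnnegZ => //; rewrite invr_ge0 ltW.
by apply: jpos_scal; rewrite invr_gt0.
Qed.

(** Both a and |a| - a are positive elements of the algebra of a. *)
Lemma jnneg_sq_le a : jnneg a -> jnneg (`|a| *: a - a ∘ a).
Proof.
move=> a0; have [cA Aa] := (calg_ca a, calg_id a).
have -> : `|a| *: a - a ∘ a = (`|a| *: 1J - a) ∘ a by rewrite !jmulE.
apply: (jnneg_mul cA) => //; last exact: jnneg_ballB.
by apply: (caB cA) => //; exact: (ca_scal cA).
Qed.

End OrderUnitCone.
Arguments scal_norm_le {R V} [t].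
Arguments jone_norm_le1 {R} V.

(** * Positivity of the quadratic operators *)

Section QuadraticOperators.
Variables (R : realType) (V : jbAlgType R).
Implicit Types (x y z u v w a b c d p q : V) (s t r e : R) (A : set V).
Local Notation "x ∘ y" := (jmul x y) (at level 40, left associativity).
Local Notation "1J" := (@jone R V).

Lemma UopD x u v : Uop x (u + v) = Uop x u + Uop x v.
Proof. by rewrite /Uop !jmulE; module. Qed.
Lemma UopZ x t v : Uop x (t *: v) = t *: Uop x v.
Proof. by rewrite /Uop !jmulE; module. Qed.
Lemma UopN x v : Uop x (- v) = - Uop x v.
Proof. by rewrite -scaleN1r UopZ scaleN1r. Qed.
Lemma UopB x u v : Uop x (u - v) = Uop x u - Uop x v.
Proof. by rewrite UopD UopN. Qed.
Lemma Uop_scal t x v : Uop (t *: x) v = t ^+ 2 *: Uop x v.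
Proof. by rewrite /Uop !jmulE; module. Qed.
Lemma Uop1 v : Uop 1J v = v.
Proof. by rewrite /Uop !jmulE; module. Qed.
Lemma Uopx1 x : Uop x 1J = x ∘ x.
Proof. by rewrite /Uop !jmulE; module. Qed.

Lemma Uop_ca A x v : commutative_subalgebra A -> A x -> A v ->
  Uop x v = x ∘ x ∘ v.
Proof. by move=> cA Ax Av; rewrite /Uop -(ca_assoc cA)//; module. Qed.

Lemma Uop_norm x v : `|Uop x v| <= 3 * `|x| ^+ 2 * `|v|.
Proof.
rewrite (le_trans (ler_normB _ _))// normrZ ger0_norm//.
have H1 := jnormM x (x ∘ v); have H2 := jnormM (x ∘ x) v.
have H3 : `|x| * `|x ∘ v| <= `|x| * (`|x| * `|v|) by rewrite ler_wpM2l// jnormM.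
have H4 : `|x ∘ x| * `|v| <= (`|x| * `|x|) * `|v| by rewrite ler_wpM2r// jnormM.
move: H1 H2 H3 H4; rewrite expr2 mulrA; lra.
Qed.

Lemma Uop_cancel A x y v : commutative_subalgebra A -> A x -> A y ->
  x ∘ y = 1J -> Uop x (Uop y v) = v.
Proof. by move=> cA Ax Ay xy; rewrite -(UopM cA)// xy Uop1. Qed.

(** To first order in z, the operator of 1 + z is positive: completing the
    square, 2 z a >= - |a| z^2 - a^2 / |a|, and a^2 <= |a| a. *)
Lemma Uop_near1_ge z a : jnneg a ->
  jnneg (Uop (1J + z) a + (4 * `|z| ^+ 2 * `|a|) *: 1J).
Proof.
move=> a0; have [->|a_neq0] := eqVneq a 0.
  by rewrite -(scale0r (0 : V)) UopZ !scale0r normr0 mulr0 scale0r addr0; exact: jnneg0.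
have r0 : 0 < `|a| by rewrite normr_gt0.
have -> : Uop (1J + z) a + (4 * `|z| ^+ 2 * `|a|) *: 1J =
   `|a|^-1 *: ((`|a| *: z + a) ∘ (`|a| *: z + a)) +
   `|a|^-1 *: (`|a| *: a - a ∘ a) +
   `|a| *: ((`|z| ^+ 2) *: 1J - z ∘ z) +
   ((3 * `|z| ^+ 2 * `|a|) *: 1J + Uop z a).
  have -> : `|a|^-1 *: ((`|a| *: z + a) ∘ (`|a| *: z + a)) +
   `|a|^-1 *: (`|a| *: a - a ∘ a) =
    `|a|^-1 *: (`|a| *: (`|a| *: (z ∘ z) + 2 *: (z ∘ a) + a)).
    by rewrite !jmulE (jmulC a z); module.
  rewrite scalerA mulVf ?gt_eqF// scale1r /Uop !jmulE; module.
apply: jnnegD; first apply: jnnegD; first apply: jnnegD.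
- by apply: jnnegZ; [rewrite invr_ge0 ltW|exact: jnneg_sq].
- by apply: jnnegZ; [rewrite invr_ge0 ltW|exact: jnneg_sq_le].
- by apply: jnnegZ; [exact: ltW|apply: jnneg_ballB; rewrite jnorm_sqr].
- by apply: jnneg_ballD; exact: Uop_norm.
Qed.

(** The operator of 1 - u is the product of n operators of elements within
    O(1/n) of the unit, each of which is positive up to O(1/n^2). *)
Lemma Uop_nneg_near1 u a : `|u| < 1 -> jnneg a -> jnneg (Uop (1J - u) a).
Proof.
move=> u1 a0; have [cA Au] := (calg_ca u, calg_id u); set A := calg u in cA Au.
pose M := `|u| / (1 - `|u|); pose s := 1 - `|u|.
have s0 : 0 < s by rewrite subr_gt0.
have M0 : 0 <= M by rewrite divr_ge0// ltW.
pose C := 48 * M ^+ 2 * (`|a| + 1) / s ^+ 2.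
have C0 : 0 <= C.
  by rewrite divr_ge0 ?sqr_ge0// mulr_ge0 ?addr_ge0// mulr_ge0// sqr_ge0.
have step n : (0 < n)%N -> C <= n%:R ->
  jnneg (Uop (1J - u) (a + (C / n%:R) *: 1J)).
  move=> n0 Cn; have n0' : 0 < n%:R :> R by rewrite ltr0n.
  pose k := C / n%:R ^+ 2.
  have k0 : 0 <= k by rewrite divr_ge0// sqr_ge0.
  pose c (i : nat) := 1J - (i%:R / n%:R) *: u.
  have cu i : (i <= n)%N -> `|(i%:R / n%:R) *: u| <= `|u|.
    move=> ni; rewrite normrZ ger0_norm ?divr_ge0// ler_piMl//.
    by rewrite ler_pdivrMr// mul1r ler_nat.
  have Ac i : A (c i) by apply: (caB cA); [exact: (ca1 cA)|exact: (caZ cA)].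
  have E : forall i, (i <= n)%N -> jnneg (Uop (c i) (a + (i%:R * k) *: 1J)).
    elim=> [_|i IH ni].
      by rewrite /c !mul0r !scale0r subr0 addr0 Uop1.
    set b := Uop (c i) _ in IH; have {IH}b0 := IH (ltnW ni).
    have [|y [Ay yn cy]] := inv_near1 cA (caZ cA (i%:R / n%:R) Au).
      by rewrite (le_lt_trans (cu _ (ltnW ni))).
    pose z := - (n%:R^-1 *: (u ∘ y)).
    have Az : A z by apply: (caN cA); apply: (caZ cA); exact: (caM cA).
    have cE : c i.+1 = (1J + z) ∘ c i.
      have -> : (1J + z) ∘ c i = c i - n%:R^-1 *: (u ∘ (c i ∘ y)).
        by rewrite /z jmulDl jmul1x jmulNl jmulZl (ca_assoc cA)// (jmulC y).
      by rewrite [c i ∘ y]cy jmulx1 /c -natr1; module.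
    have zM : `|z| <= M / n%:R.
      rewrite normrN normrZ gtr0_norm ?invr_gt0// mulrC ler_pM2r ?invr_gt0//.
      rewrite (le_trans (jnormM _ _))// ler_wpM2l// (le_trans yn)//.
      by rewrite lef_pV2 ?posrE ?subr_gt0 ?lerB// ?cu// 1?ltnW// (le_lt_trans (cu _ (ltnW ni))).
    have -> : Uop (c i.+1) (a + (i.+1%:R * k) *: 1J) =
       (Uop (1J + z) b + (4 * `|z| ^+ 2 * `|b|) *: 1J) +
       (k *: (c i.+1 ∘ c i.+1 - s ^+ 2 *: 1J) +
       (k * s ^+ 2 - 4 * `|z| ^+ 2 * `|b|) *: 1J).
      rewrite -Uopx1 {1 2}cE /b -(UopM cA)//; last first.
        by apply: (caD cA) => //; exact: (ca1 cA).
      by rewrite -natr1 !UopD !UopZ; module.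
    apply: jnnegD; first exact: Uop_near1_ge.
    apply: jnnegD.
      apply: jnnegZ => //.
      have d0 : jnneg (c i.+1 - s *: 1J).
        have -> : c i.+1 - s *: 1J = `|u| *: 1J - (i.+1%:R / n%:R) *: u.
          by rewrite /c /s; module.
        by apply: jnneg_ballB; exact: cu.
      set d := c i.+1 - s *: 1J in d0.
      have -> : c i.+1 = d + s *: 1J by rewrite /d subrK.
      have -> : (d + s *: 1J) ∘ (d + s *: 1J) - s ^+ 2 *: 1J =
        d ∘ d + (2 * s) *: d by rewrite !jmulE; module.
      apply: jnnegD; first exact: jnneg_sq.
      by apply: jnnegZ => //; rewrite mulr_ge0// ltW.
    apply: jnneg_scal; rewrite subr_ge0.
    have bn : `|b| <= 12 * (`|a| + 1).
      rewrite (le_trans (Uop_norm _ _))//.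
      have cn : `|c i| <= 2.
        rewrite (le_trans (ler_normB _ _))// [leRHS](_ : 2 = 1 + 1)//.
        rewrite lerD ?(jone_norm_le1 V)// (le_trans (cu _ (ltnW ni)))// ltW//.
      have c4 : `|c i| ^+ 2 <= 2 ^+ 2 by rewrite ler_pXn2r// nnegrE.
      have an : `|a + (i%:R * k) *: 1J| <= `|a| + 1.
        rewrite (le_trans (ler_normD _ _))// lerD2l.
        apply: le_trans (scal_norm_le (mulr_ge0 (ler0n _ _) k0)) _.
        rewrite /k expr2 mulrA ler_pdivrMr ?mulr_gt0// mul1r.
        by apply: ler_pM => //; rewrite ler_nat ltnW.
      apply: ler_pM => //; rewrite ?mulr_ge0 ?sqr_ge0//.
      by move: c4; lra.
    have z2 : `|z| ^+ 2 <= (M / n%:R) ^+ 2.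
      have Mn : 0 <= M / n%:R by apply: divr_ge0 => //; exact: ltW.
      by rewrite ler_pXn2r ?nnegrE.
    have -> : k * s ^+ 2 = 4 * (M / n%:R) ^+ 2 * (12 * (`|a| + 1)).
      rewrite /k /C; field; rewrite !gt_eqF//.
    by apply: ler_pM => //; rewrite ?mulr_ge0 ?sqr_ge0// ler_wpM2l.
  have := E n (leqnn n); rewrite /c divff ?gt_eqF// scale1r.
  by have -> : n%:R * k = C / n%:R by rewrite /k; field; rewrite gt_eqF.
apply: (@jnneg_arch _ _ _ (C *: ((1J - u) ∘ (1J - u)))) => e e0.
pose n := (Num.truncn (C + e^-1)).+1.
have nC : C + e^-1 < n%:R by rewrite /n; apply: truncnS_gt.
have n0 : 0 < n%:R :> R by rewrite ltr0n.
have ei : 0 < e^-1 by rewrite invr_gt0.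
have := step n isT (ltW (lt_trans (ltr_pwDr ei (lexx C)) nC)).
rewrite UopD UopZ Uopx1 => H.
set q := (1J - u) ∘ _ in H *.
have -> : Uop (1J - u) a + e *: (C *: q) =
  (Uop (1J - u) a + (C / n%:R) *: q) + (C * (e - n%:R^-1)) *: q by module.
apply: jnnegD => //; apply: jnnegZ; last exact: jnneg_sq.
rewrite mulr_ge0// subr_ge0 -[e]invrK lef_pV2 ?posrE//.
by rewrite ltW// (le_lt_trans _ nC)// lerDr.
Qed.

Lemma Uop_nneg q a : jpos q -> jnneg a -> jnneg (Uop q a).
Proof.
move=> [r r0 rq] a0; have r_neq0 : r != 0 by rewrite gt_eqF.
have -> : q = r *: (1J - r^-1 *: (r *: 1J - q)).
  by rewrite scalerBr scalerA divff// scale1r; module.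
rewrite Uop_scal; apply: jnnegZ; first exact: sqr_ge0.
apply: Uop_nneg_near1 => //.
by rewrite normrZ gtr0_norm ?invr_gt0// ltr_pdivrMl// mulr1.
Qed.

Lemma jpos_sq q : jpos q -> jpos (q ∘ q).
Proof.
move=> q0; have [cA Aq] := (calg_ca q, calg_id q).
have [y [Ay y0 qy]] := jpos_inv cA Aq q0.
apply: (jnneg_inv_pos cA (caM cA Aq Aq) (caM cA Ay Ay) (jnneg_sq q)).
by rewrite (ca_mulACA cA)// qy jmulx1.
Qed.

Lemma Uop_pos q a : jpos q -> jpos a -> jpos (Uop q a).
Proof.
move=> q0 /jpos_shrink[e e0 ae].
have -> : Uop q a = Uop q (a - e *: 1J) + e *: (q ∘ q).
  by rewrite UopB UopZ Uopx1 subrK.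
apply: jnneg_posD; first exact/Uop_nneg/jpos_nneg.
by apply: jposZ => //; exact: jpos_sq.
Qed.

End QuadraticOperators.

(** * Spectrum and functional calculus *)

Section SpectralTheory.
Variables (R : realType) (V : jbAlgType R).
Implicit Types (x y z u v w a b c d p q : V) (s t r e : R) (A : set V).
Local Notation "x ∘ y" := (jmul x y) (at level 40, left associativity).
Local Notation "1J" := (@jone R V).

(** A Jordan inverse commutes, at the level of operators, just enough for its
    square to be a preimage of the unit under the quadratic operator. *)
Lemma Uop_jinverse_sq z y : z ∘ y = 1J -> (z ∘ z) ∘ y = z ->
  Uop z (y ∘ y) = 1J.
Proof.
move=> zy zzy; have comm a b : a ∘ b = 1J -> opcomm (a ∘ a) b.
  move=> ab v; have := jordan_linearized a a b v.
  by rewrite ab !jmulE => /addIr/addIr.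
have E1 : (z ∘ z) ∘ (y ∘ y) = 1J by rewrite comm// zzy jmulC.
have E2 : z ∘ (z ∘ (y ∘ y)) = 1J.
  rewrite [z ∘ (y ∘ y)]jmulC -(comm y z) ?[y ∘ z]jmulC// jmulC E1.
  by [].
by rewrite /Uop E1 E2; module.
Qed.

(** If U_z w = 1 and c = (z^2 + e)^-1, then c^2 = U_(c z) w, while |c z|^2 <= |c|;
    so |c| <= 3 |w| whatever e, and z^2 is bounded below. *)
Lemma jinvertible_sq_pos z : jinvertible z -> jpos (z ∘ z).
Proof.
move=> [y [zy zzy]]; set w := y ∘ y; have Uw := Uop_jinverse_sq zy zzy.
have [cA Az] := (calg_ca z, calg_id z); set A := calg z in cA Az.
pose K := 3 * `|w| + 1; have K0 : 0 < K by rewrite ltr_wpDl// mulr_ge0.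
suff H : jnneg (K *: (z ∘ z) - 1J).
  have -> : z ∘ z = K^-1 *: (K *: (z ∘ z) - 1J) + K^-1 *: 1J.
    by rewrite scalerBr scalerA mulVf ?scale1r ?subrK// gt_eqF.
  apply: jnneg_posD; first by apply: jnnegZ => //; rewrite invr_ge0 ltW.
  by apply: jpos_scal; rewrite invr_gt0.
apply: (@jnneg_arch _ _ _ (K *: 1J)) => e e0.
have Azz := caM cA Az Az; have Ae := ca_scal cA e.
have [c [Ac c0 zc]] := jpos_inv cA (caD cA Azz Ae) (jnneg_sq z e0).
have czz : c ∘ (z ∘ z) = 1J - e *: c.
  by rewrite -zc !jmulE [c ∘ _]jmulC; module.
have cK : `|c| <= K.
  have c1 : `|1J - e *: c| <= 1.
    apply: jnorm_le => //; rewrite scale1r.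
      rewrite -czz addrC -[1J]scale1r; apply: jnnegD; last exact: jnneg_scal.
      by apply: (jnneg_mul cA) => //; [exact: jpos_nneg|exact: jnneg_sq].
    have -> : 1J - (1J - e *: c) = e *: c by module.
    by apply: jnnegZ; [exact: ltW|exact: jpos_nneg].
  have cz : `|c ∘ z| ^+ 2 <= `|c|.
    rewrite -jnorm_sqr (ca_mulACA cA)// (ca_assoc cA)// czz.
    by rewrite (le_trans (jnormM _ _))// ler_piMr.
  have : `|c| ^+ 2 <= 3 * `|w| * `|c|.
    rewrite -jnorm_sqr -(Uopx1 c) -Uw -(UopM cA)//.
    rewrite (le_trans (Uop_norm _ _))// [leRHS]mulrAC.
    by rewrite ler_wpM2r// ler_wpM2l.
  have [->|c_neq0] := eqVneq c 0; first by rewrite normr0 (ltW K0).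
  rewrite expr2 ler_pM2r ?normr_gt0// => /le_trans; apply.
  by rewrite /K lerDl.
have : jnneg ((K *: 1J - c) ∘ (z ∘ z + e *: 1J)).
  apply: (jnneg_mul cA); first exact: (caB cA (ca_scal cA K) Ac).
  - exact: (caD cA).
  - exact: jnneg_ballB.
  - exact/jpos_nneg/jnneg_sq.
by rewrite jmulDl jmulNl [c ∘ _]jmulC zc !jmulE; congr jnneg; module.
Qed.

(** z^-1 = z (z^2)^-1, where z^2 is positive. *)
Lemma jinvertible_ca A z : commutative_subalgebra A -> A z ->
  jinvertible z <-> exists2 y, A y & z ∘ y = 1J.
Proof.
move=> cA Az; split=> [/jinvertible_sq_pos zz|[y Ay zy]]; last first.
  by exists y; rewrite (ca_assoc cA)// zy jmulx1.
have [d [Ad _ zd]] := jpos_inv cA (caM cA Az Az) zz.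
by exists (z ∘ d); [exact: (caM cA)|rewrite -(ca_assoc cA)].
Qed.

Lemma jpos_jinvertible z : jpos z -> jinvertible z.
Proof.
move=> z0; apply/(jinvertible_ca (calg_ca z) (calg_id z)).
by have [y [Ay _ zy]] := jpos_inv (calg_ca z) (calg_id z) z0; exists y.
Qed.

Lemma jnneg_jinvertible_pos z : jnneg z -> jinvertible z -> jpos z.
Proof.
move=> z0 /(jinvertible_ca (calg_ca z) (calg_id z))[y Ay zy].
exact: (jnneg_inv_pos (calg_ca z) (calg_id z) Ay z0 zy).
Qed.

(** If x had positive spectrum without being in the open cone, then the first
    translate x + t of x that reaches the closed cone would be invertible,
    hence would already be in the open cone. *)
Lemma OmegaP x : Omega x <-> jpos x.
Proof.
split=> [Ox|x0 t nt /=]; last first.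
  rewrite ltNge; apply/negP => t0; apply: nt; apply: jpos_jinvertible.
  rewrite -scaleNr addrC; apply: jnneg_posD => //.
  by apply: jnneg_scal; rewrite oppr_ge0.
pose S : set R := [set t | 0 <= t /\ jnneg (x + t *: 1J)].
have lS : has_lbound S by exists 0 => t [].
have infS : has_inf S.
  split; last exact: lS.
  by exists `|x|; split=> //; rewrite addrC; exact: jnneg_ballD.
have t0 : 0 <= inf S by apply: lb_le_inf; [case: infS|move=> t []].
have xt0 : jnneg (x + inf S *: 1J).
  apply: jnneg_closed => e e0; have [t [t0' xt] te] := inf_adherent e0 infS.
  have -> : x + inf S *: 1J + e *: 1J = x + t *: 1J + (inf S + e - t) *: 1J.
    by module.
  by apply: jnnegD => //; apply: jnneg_scal; rewrite subr_ge0 ltW.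
have xt : jpos (x + inf S *: 1J).
  apply: jnneg_jinvertible_pos => //; apply: contrapT => N.
  have /Ox /= : jspectrum x (- inf S) by rewrite /jspectrum /= scaleNr opprK.
  by rewrite oppr_gt0 ltNge t0.
have [inf0|inf_neq0] := eqVneq (inf S) 0; first by move: xt; rewrite inf0 scale0r addr0.
have [e e0 xe] := jpos_shrink xt.
have : inf S <= Num.max 0 (inf S - e).
  apply: ge_inf => //; split; first by rewrite le_max lexx.
  have -> : x + Num.max 0 (inf S - e) *: 1J =
    (x + inf S *: 1J - e *: 1J) + (Num.max 0 (inf S - e) - (inf S - e)) *: 1J.
    by module.
  apply: jnnegD; first exact: jpos_nneg.
  by apply: jnneg_scal; rewrite subr_ge0 le_max lexx orbT.
rewrite le_max leNgt lt_neqAle eq_sym inf_neq0 t0 /=.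
by rewrite lerBrDl gerDr leNgt e0.
Qed.

Lemma jhorner_ca A (P : {poly R}) p : commutative_subalgebra A -> A p ->
  A (jhorner P p).
Proof.
move=> cA Ap; elim/poly_ind: P => [|P c IH].
  by rewrite -polyC0 jhornerC scale0r; exact: ca0.
rewrite jhornerD jhornerMX jhornerC; apply: (caD cA); first exact: (caM cA).
exact: ca_scal.
Qed.

(** A nonreal complex root a + i b is also a root of (X - a)^2 + b^2, and a
    remainder of degree at most 1 with a nonreal root vanishes. *)
Lemma real_poly_factor (G : {poly R}) : (1 < size G)%N ->
  (exists (D : {poly R}) (a : R), G = D * ('X - a%:P)) \/
  (exists (D : {poly R}) (a b : R), b != 0 /\ G = D * (('X - a%:P) ^+ 2 + (b ^+ 2)%:P)).
Proof.
move=> G1; pose f : {rmorphism R -> R[i]} := real_complex R.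
have : size (map_poly f G) != 1 by rewrite size_map_poly; case: (size G) G1 => [|[]].
move/closed_rootP => [[a b] ab].
have [b0|b0] := eqVneq b 0.
  left; have : root G a.
    move: ab; rewrite b0; have -> : Complex a 0 = f a by [].
    by rewrite fmorph_root.
  by move/factor_theorem => [D ->]; exists D, a.
right; set Q := ('X - a%:P) ^+ 2 + (b ^+ 2)%:P.
exists (G %/ Q), a, b; split=> //.
have sQ : size Q = 3%N.
  rewrite size_polyDl size_exp_XsubC// size_polyC.
  by case: (_ == _).
rewrite {1}(divp_eq G Q); suff -> : G %% Q = 0 by rewrite addr0.
have sr : (size (G %% Q)%R <= 2)%N by rewrite -ltnS -sQ ltn_modp -size_poly_eq0 sQ.
have [al [be rE]] : exists al be, G %% Q = al *: 'X + be%:P.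
  exists (G %% Q)`_1, (G %% Q)`_0; apply/polyP => -[|[|i]].
  - by rewrite coefD coefZ coefX coefC mulr0 add0r.
  - by rewrite coefD coefZ coefX coefC mulr1 addr0.
  rewrite coefD coefZ coefX coefC mulr0 addr0 nth_default//.
  by rewrite (leq_trans sr).
have : (map_poly f (G %% Q)).[Complex a b] = 0.
  move/rootP: ab; rewrite {1}(divp_eq G Q) rmorphD rmorphM hornerD hornerM.
  suff -> : (map_poly f Q).[Complex a b] = 0 by rewrite mulr0 add0r.
  rewrite /Q rmorphD rmorphXn rmorphB /= map_polyX !map_polyC /= !hornerE.
  by rewrite /f expr2; simpc; rewrite expr2 addNr.
rewrite rE rmorphD /= map_polyC /= map_polyZ map_polyX !hornerE /=.
rewrite /f; simpc => -[E1 E2].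
have al0 : al = 0 by move/eqP: E2; rewrite mulf_eq0 (negbTE b0) orbF => /eqP.
by move: E1; rewrite al0 mul0r add0r => ->; rewrite scale0r add0r.
Qed.

(** Over a real closed field every polynomial is a product of linear factors,
    invertible at p when their root is outside the spectrum, and of factors
    (X - a)^2 + b^2, whose value at p is positive. *)
Lemma jhorner_inv A (G : {poly R}) p : commutative_subalgebra A -> A p ->
  (forall t, jspectrum p t -> G.[t] != 0) ->
  exists2 y, A y & jhorner G p ∘ y = 1J.
Proof.
move=> cA Ap Gs.
have mulP a b : A a -> A b -> (exists2 y, A y & a ∘ y = 1J) ->
   (exists2 y, A y & b ∘ y = 1J) -> exists2 y, A y & (a ∘ b) ∘ y = 1J.
  move=> Aa Ab [y Ay ay] [z Az bz]; exists (y ∘ z); first exact: (caM cA).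
  by rewrite (ca_mulACA cA)// ay bz jmulx1.
have posP a : A a -> jpos a -> exists2 y, A y & a ∘ y = 1J.
  by move=> Aa a0; have [y []] := jpos_inv cA Aa a0; exists y.
have linE (a : R) : jhorner ('X - a%:P) p = p - a *: 1J.
  by rewrite -polyCN jhornerD jhornerX jhornerC scaleNr.
move: {2}(size G) (leqnn (size G)) => n; elim: n G Gs => [|n IH] G Gs Gn.
  have G0 : G = 0 by apply/eqP; rewrite -size_poly_leq0.
  (* If the zero polynomial has no root in the spectrum, the spectrum is empty;
     then so is that of - p, and translates of p and of - p that add up to 0
     are positive. *)
  have sp0 t : ~ jspectrum p t by move=> /Gs; rewrite G0 horner0 eqxx.
  have p1 : jpos (p - (`|p| + 1) *: 1J).
    apply/OmegaP => t nt; exfalso; apply: (sp0 (`|p| + 1 + t)).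
    by move: nt; rewrite /jspectrum /= -addrA -opprD -scalerDl.
  have p2 : jpos ((`|p| + 1) *: 1J - p).
    by apply: jpos_ball; rewrite normrN ltrDl.
  rewrite G0 -polyC0 jhornerC scale0r; apply: posP; first exact: (ca0 cA).
  by have := jposD p1 p2; rewrite addrA subrK subrr.
have [G1|G1] := leqP (size G) 1.
  have [c E] : exists c : R, G = c%:P by exists G`_0; exact: size1_polyC.
  have [c0|c0] := eqVneq c 0.
    by apply: IH => //; rewrite E c0 size_poly0.
  exists (c^-1 *: 1J); first exact: (ca_scal cA).
  by rewrite E jhornerC !jmulE scalerA mulfV// scale1r.
have [[D [a E]]|[D [a [b [b0 E]]]]] := real_poly_factor G1.
  have D0 : D != 0 by apply: contraTneq G1 => D0; rewrite E D0 mul0r size_poly0.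
  rewrite E jhornerM; apply: mulP; do ?exact: (jhorner_ca _ cA).
    apply: IH => [t /Gs|]; first by rewrite E hornerM mulf_eq0 negb_or => /andP[].
    move: Gn; rewrite E size_Mmonic ?monicXsubC// size_XsubC addn2 /=.
    by rewrite ltnS.
  rewrite linE; apply/(jinvertible_ca cA).
    by apply: (caB cA) => //; exact: (ca_scal cA).
  apply: contrapT => /Gs; rewrite E hornerM !hornerE subrr mulr0 eqxx.
  by [].
have D0 : D != 0 by apply: contraTneq G1 => D0; rewrite E D0 mul0r size_poly0.
rewrite E jhornerM; apply: mulP; do ?exact: (jhorner_ca _ cA).
  apply: IH => [t /Gs|]; first by rewrite E hornerM mulf_eq0 negb_or => /andP[].
  have sQ : size (('X - a%:P) ^+ 2 + (b ^+ 2)%:P) = 3%N.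
    by rewrite size_polyDl size_exp_XsubC// size_polyC; case: (_ == _).
  have Q0 : ('X - a%:P) ^+ 2 + (b ^+ 2)%:P != 0 by rewrite -size_poly_eq0 sQ.
  move: Gn; rewrite E size_mul// sQ addn3 /= => /ltnW.
  by rewrite ltnS.
apply: posP; first exact: (jhorner_ca _ cA).
rewrite expr2 jhornerD jhornerM linE jhornerC; apply: jnneg_posD.
  exact: jnneg_sq.
by apply: jpos_scal; rewrite exprn_even_gt0//= b0.
Qed.

Lemma jhorner_pos (G : {poly R}) p : (forall t, jspectrum p t -> 0 < G.[t]) ->
  jpos (jhorner G p).
Proof.
move=> G0; apply/OmegaP => s ns /=; rewrite ltNge; apply/negP => s0; apply: ns.
have [cA Ap] := (calg_ca p, calg_id p).
have -> : jhorner G p - s *: 1J = jhorner (G - s%:P) p.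
  by rewrite -polyCN jhornerD jhornerC scaleNr.
apply/(jinvertible_ca cA); first exact: (jhorner_ca _ cA).
apply: (jhorner_inv cA Ap) => t /G0 Gt.
by rewrite hornerD hornerN hornerC subr_eq0 gt_eqF// (le_lt_trans s0).
Qed.

Lemma jhorner_norm_le (G : {poly R}) p e : 0 <= e ->
  (forall t, jspectrum p t -> `|G.[t]| <= e) -> `|jhorner G p| <= e.
Proof.
move=> e0 Ge; apply: jnorm_le => // d d0.
  have -> : e *: 1J + jhorner G p + d *: 1J = jhorner ((e + d)%:P + G) p.
    by rewrite jhornerD jhornerC; module.
  apply: jhorner_pos => t /Ge; rewrite hornerD hornerC ler_norml => /andP[]; lra.
have -> : e *: 1J - jhorner G p + d *: 1J = jhorner ((e + d)%:P + (-1) *: G) p.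
  by rewrite jhornerD jhornerC jhornerZ; module.
apply: jhorner_pos => t /Ge; rewrite hornerD hornerC hornerZ ler_norml.
by move=> /andP[]; lra.
Qed.

(** If |G(t)| exceeds |G(p)| then G(p) - G(t) is invertible by a Neumann series,
    and so is its factor p - t. *)
Lemma jspectrum_norm_le (G : {poly R}) p t : jspectrum p t ->
  `|G.[t]| <= `|jhorner G p|.
Proof.
move=> pt; rewrite leNgt; apply/negP => Gt; apply: pt.
have [cA Ap] := (calg_ca p, calg_id p); set A := calg p in cA Ap.
set s := G.[t] in Gt; have s0 : s != 0 by rewrite -normr_gt0 (le_lt_trans _ Gt).
apply/(jinvertible_ca cA); first by apply: (caB cA) => //; exact: (ca_scal cA).
have AG := jhorner_ca G cA Ap.
have [||y [Ay _ Gy]] := @inv_near1 _ _ A (s^-1 *: jhorner G p) cA.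
- exact: (caZ cA).
- rewrite normrZ normfV ltr_pdivrMl ?mulr1// normr_gt0//.
have : root (G - s%:P) t by rewrite /root hornerD hornerN hornerC subrr.
move=> /factor_theorem[D E].
exists (jhorner D p ∘ (- (s^-1 *: y))).
  by apply: (caM cA); [exact: (jhorner_ca _ cA)|apply: (caN cA); exact: (caZ cA)].
rewrite -(ca_assoc cA); do ?[exact: (jhorner_ca _ cA)|apply: (caN cA); exact: (caZ cA)];
  last by apply: (caB cA) => //; exact: (ca_scal cA).
have -> : (p - t *: 1J) ∘ jhorner D p = jhorner G p - s *: 1J.
  have -> : jhorner G p - s *: 1J = jhorner (G - s%:P) p.
    by rewrite -polyCN jhornerD jhornerC scaleNr.
  by rewrite E jhornerM -polyCN jhornerD jhornerX jhornerC scaleNr jmulC.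
by rewrite -[RHS]Gy !jmulE !scalerA mulfV//; module.
Qed.

Lemma is_fcalc_uniq (f : R -> R) p y y' : is_fcalc f p y -> is_fcalc f p y' ->
  y = y'.
Proof.
move=> fy fy'; apply/eqP; rewrite -subr_eq0 -normr_le0; apply/ler_addgt0Pl => e e0.
have e4 : 0 < e / 4 by rewrite divr_gt0.
have [P [Pf Py]] := fy _ e4; have [Q [Qf Qy]] := fy' _ e4.
have : `|jhorner (P + (-1) *: Q) p| <= e / 4 + e / 4.
  apply: jhorner_norm_le => [|t pt]; first by rewrite addr_ge0// ltW.
  have -> : (P + (-1) *: Q).[t] = (P.[t] - f t) + (f t - Q.[t]).
    by rewrite hornerD hornerZ; ring.
  by rewrite (le_trans (ler_normD _ _))// lerD ?Pf// distrC Qf.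
have -> : y - y' = - (jhorner P p - y) + jhorner (P + (-1) *: Q) p +
   (jhorner Q p - y').
  by rewrite jhornerD jhornerZ; module.
move=> H.
have H1 := ler_normD (- (jhorner P p - y) + jhorner (P + (-1) *: Q) p)
  (jhorner Q p - y').
have H2 := ler_normD (- (jhorner P p - y)) (jhorner (P + (-1) *: Q) p).
rewrite normrN in H2; lra.
Qed.

(** The functional calculus value at p of an inverse square root q of p in the
    algebra of p. The polynomials are taken of the form d + Q^2, so that they
    are positive everywhere and their squares determine them on the spectrum. *)
Lemma is_fcalc_invsqrt p q : calg p q -> jpos p -> jpos q -> q ∘ q ∘ p = 1J ->
  is_fcalc (fun t => (Num.sqrt t)^-1) p q.
Proof.
have [cA Ap] := (calg_ca p, calg_id p); set A := calg p in cA Ap.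
move=> Aq p0 q0 qqp e e0.
have [m m0 pm] := jpos_shrink p0; have [d d0 qd] := jpos_shrink q0.
have Ad := ca_scal cA d.
have [b [Ab _ bb]] := jsqrt_exists cA (caB cA Aq Ad) qd.
pose g v : V := v ∘ v + d *: 1J.
have gb : g b = q by rewrite /g bb subrK.
pose et := e * Num.sqrt m; have et0 : 0 < et by rewrite mulr_gt0// sqrtr_gt0.
have gc : g v @[v --> b] --> q.
  by rewrite -gb; apply: cvgD; [apply: cvg_jmul; exact: cvg_id|exact: cvg_cst].
have Gc : g v ∘ g v ∘ p @[v --> b] --> 1J.
  rewrite -qqp; apply: cvg_jmul; last exact: cvg_cst.
  exact: cvg_jmul.
have : \forall v \near b, `|q - g v| <= e /\ `|1J - g v ∘ g v ∘ p| <= et.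
  near=> v; split; near: v; [move/cvgrPdist_le : gc|move/cvgrPdist_le : Gc]; exact.
move=> /(Ab _) [_ [[Q _ <-] [Q1 Q2]]].
pose P := Q * Q + d%:P.
have PE : jhorner P p = g (jhorner Q p) by rewrite jhornerD jhornerM jhornerC.
exists P; split; last by rewrite PE distrC.
move=> t pt.
have tm : m <= t.
  rewrite leNgt; apply/negP => tm; apply: pt; apply: jpos_jinvertible.
  have -> : p - t *: 1J = (p - m *: 1J) + (m - t) *: 1J by module.
  by apply: jposD => //; apply: jpos_scal; rewrite subr_gt0.
have t0 : 0 < t by rewrite (lt_le_trans m0).
have Pt0 : 0 < P.[t].
  by rewrite hornerD hornerM hornerC ltr_wpDl// -expr2 sqr_ge0.
have st0 : 0 < Num.sqrt t by rewrite sqrtr_gt0.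
have : `|1 - P.[t] ^+ 2 * t| <= et.
  have := @jspectrum_norm_le (1%:P - P * P * 'X) p t pt.
  rewrite !hornerE => /le_trans; apply.
  have -> : jhorner (1%:P - P * P * 'X) p = 1J - g (jhorner Q p) ∘ g (jhorner Q p) ∘ p.
    rewrite -scaleN1r jhornerD jhornerZ jhornerC jhornerMX jhornerM PE [p ∘ _]jmulC.
    by module.
  by [].
move=> H.
have E : 1 - P.[t] ^+ 2 * t = (1 - P.[t] * Num.sqrt t) * (1 + P.[t] * Num.sqrt t).
  have -> : P.[t] ^+ 2 * t = P.[t] ^+ 2 * Num.sqrt t ^+ 2.
    by rewrite sqr_sqrtr// ltW.
  by ring.
have : `|1 - P.[t] * Num.sqrt t| <= et.
  apply: le_trans H; rewrite E normrM ler_peMr//.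
  by rewrite ger0_norm ?lerDl ?addr_ge0// ?mulr_ge0// ltW.
have -> : P.[t] - (Num.sqrt t)^-1 = - (Num.sqrt t)^-1 * (1 - P.[t] * Num.sqrt t).
  by field; rewrite gt_eqF.
rewrite normrM normrN normfV (gtr0_norm st0) => H2.
rewrite ler_pdivrMl// [leRHS]mulrC (le_trans H2)// ler_wpM2l ?(ltW e0)//.
by rewrite ler_sqrt// ltW.
Unshelve. all: end_near. Qed.

Lemma jsqrtV_spec p : Omega p ->
  [/\ calg p (jsqrtV p), jpos (jsqrtV p) & jsqrtV p ∘ jsqrtV p ∘ p = 1J].
Proof.
move=> /OmegaP p0; have [cA Ap] := (calg_ca p, calg_id p).
have [y [Ay y0 py]] := jpos_inv cA Ap p0.
have [q [Aq q0 qq]] := jsqrt_exists cA Ay y0.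
have qqp : q ∘ q ∘ p = 1J by rewrite qq jmulC.
suff -> : jsqrtV p = q by [].
have fq := is_fcalc_invsqrt Aq p0 q0 qqp.
apply: (is_fcalc_uniq _ fq).
exact: (@getPex _ [set y | is_fcalc (fun t => (Num.sqrt t)^-1) p y] (ex_intro _ q fq)).
Qed.

End SpectralTheory.

(** * The structure group *)

Section StructureGroup.
Variables (R : realType) (V : jbAlgType R).
Implicit Types (x y z u v w a b c p q : V) (s t r e : R) (A : set V)
  (g h k : bop V).
Local Notation "x ∘ y" := (jmul x y) (at level 40, left associativity).
Local Notation "1J" := (@jone R V).

Lemma Lbop_subproof x : (fun v => x ∘ v) \in @bounded_linear_pred R V.
Proof.
apply/asboolP; split; first by move=> t u v; rewrite !jmulE.
by exists `|x| => v; exact: jnormM.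
Qed.
Definition Lbop x : bop V := BOp (Lbop_subproof x).

Lemma Ubop_subproof x : (fun v => Uop x v) \in @bounded_linear_pred R V.
Proof.
apply/asboolP; split; first by move=> t u v; rewrite UopD UopZ.
by exists (3 * `|x| ^+ 2) => v; exact: Uop_norm.
Qed.
Definition Ubop x : bop V := BOp (Ubop_subproof x).

Lemma bopD g u v : g (u + v) = g u + g v. Proof. exact: linearD. Qed.
Lemma bopN g v : g (- v) = - g v. Proof. exact: linearN. Qed.
Lemma bopZ g t v : g (t *: v) = t *: g v. Proof. exact: linearZ. Qed.
Definition bopE := (bopD, bopN, bopZ).

Lemma is_binvP g h : is_binv g h <-> cancel h g /\ cancel g h.
Proof.
split=> [[gh hg]|[gh hg]]; last by split; apply: bopP => v /=.
by split=> v; [move/(congr1 (fun f : bop V => f v)): gh|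
  move/(congr1 (fun f : bop V => f v)): hg].
Qed.

Lemma binvP g : GL g -> is_binv g (binv g).
Proof. by move=> gG; exact: getPex. Qed.

Lemma binvK g : GL g -> cancel (binv g) g.
Proof. by move=> /binvP/is_binvP[]. Qed.

Lemma binvK' g : GL g -> cancel g (binv g).
Proof. by move=> /binvP/is_binvP[]. Qed.

Lemma GL_binv g : GL g -> GL (binv g).
Proof. by move=> gG; exists g; apply/is_binvP; split; [exact: binvK'|exact: binvK]. Qed.

Lemma GL_comp g h : GL g -> GL h -> GL (bcomp g h).
Proof.
move=> gG hG; exists (bcomp (binv h) (binv g)); apply/is_binvP.
by split=> v /=; rewrite ?binvK ?binvK'.
Qed.

Lemma binv_uniq g h : cancel g h -> GL g -> binv g = h.
Proof. by move=> gh gG; apply: bopP => v; rewrite -[LHS]gh binvK. Qed.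

Lemma GOmegaP g :
  GOmega g <-> GL g /\ (forall v, jpos (g v) <-> jpos v).
Proof.
split=> [[gG gO]|[gG gO]]; split=> //.
  move=> v; split=> [/OmegaP|/OmegaP vO]; last first.
    by apply/OmegaP; rewrite -gO; exists v.
  by rewrite -gO => -[w wO /(can_inj (binvK' gG)) <-]; exact/OmegaP.
apply/seteqP; split=> [_ [v /OmegaP vO <-]|v /OmegaP vO].
  by apply/OmegaP/gO.
by exists (binv g v); [apply/OmegaP/gO|]; rewrite binvK.
Qed.

Lemma GOmega_GL g : GOmega g -> GL g. Proof. by case. Qed.

Lemma GOmega_pos g v : GOmega g -> jpos (g v) <-> jpos v.
Proof. by move=> /GOmegaP[]. Qed.

Lemma GOmega_nneg g v : GOmega g -> jnneg v -> jnneg (g v).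
Proof.
move=> gO v0; apply: (@jnneg_arch _ _ _ (g 1J)) => e e0.
by rewrite -bopZ -bopD; apply/jpos_nneg/(GOmega_pos _ gO); exact: v0.
Qed.

Lemma GOmega_binv g : GOmega g -> GOmega (binv g).
Proof.
move=> gO; have gG := GOmega_GL gO; apply/GOmegaP; split; first exact: GL_binv.
by move=> v; rewrite -(GOmega_pos _ gO) binvK.
Qed.

Lemma GOmega_comp g h : GOmega g -> GOmega h -> GOmega (bcomp g h).
Proof.
move=> gO hO; apply/GOmegaP; split; first exact: GL_comp (GOmega_GL _) (GOmega_GL _).
by move=> v /=; rewrite GOmega_pos// GOmega_pos.
Qed.

Lemma GOmega_Ubop q : jpos q -> GOmega (Ubop q).
Proof.
move=> q0; have [cA Aq] := (calg_ca q, calg_id q).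
have [y [Ay y0 qy]] := jpos_inv cA Aq q0.
have qK := Uop_cancel _ cA Aq Ay qy.
have yK v : Uop y (Uop q v) = v by apply: (Uop_cancel _ cA) => //; rewrite jmulC.
apply/GOmegaP; split; first by exists (Ubop y); apply/is_binvP.
move=> v; split=> /= v0; last exact: Uop_pos.
by rewrite -(yK v); exact: Uop_pos.
Qed.

(** The norm is determined by the order and the unit. *)
Lemma GOmega_isometry g v : GOmega g -> g 1J = 1J -> `|g v| = `|v|.
Proof.
move=> gO g1; have gG := GOmega_GL gO.
have le h w : GOmega h -> h 1J = 1J -> `|h w| <= `|w|.
  move=> hO h1; apply: jnorm_le => //.
    by rewrite -h1 -bopZ -bopD; apply: GOmega_nneg => //; exact: jnneg_ballD.
  by rewrite -h1 -bopZ -bopN -bopD; apply: GOmega_nneg => //; exact: jnneg_ballB.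
apply/eqP; rewrite eq_le le//= -{1}(binvK' gG v) le//; first exact: GOmega_binv.
by rewrite -{1}g1 binvK'.
Qed.

(** * Inversion *)

(** Characterized by U_p y = p, which has a single solution since U_p is
    invertible; a priori a Jordan inverse need not lie in the algebra of p. *)
Definition jinv p : V := get [set y | jpos y /\ Uop p y = p].

Lemma jinvE A p y : commutative_subalgebra A -> A p -> A y -> jpos p ->
  p ∘ y = 1J -> jinv p = y.
Proof.
move=> cA Ap Ay p0 py.
have [y' [Ay' y'0 py']] := jpos_inv cA Ap p0.
have [_ Uz] : [set z | jpos z /\ Uop p z = p] (jinv p).
  apply: (@getPex _ [set z | jpos z /\ Uop p z = p]); exists y'; split=> //.
  by rewrite (Uop_ca cA)// (ca_assoc cA)// py' jmulx1.
have yp : y ∘ p = 1J by rewrite jmulC.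
rewrite -(Uop_cancel (jinv p) cA Ay Ap yp) Uz (Uop_ca cA)//.
by rewrite (ca_assoc cA)// yp jmulx1.
Qed.

Lemma jinvP A p : commutative_subalgebra A -> A p -> jpos p ->
  [/\ A (jinv p), jpos (jinv p) & p ∘ jinv p = 1J].
Proof.
move=> cA Ap p0; have [y [Ay y0 py]] := jpos_inv cA Ap p0.
by rewrite (jinvE cA Ap Ay p0 py).
Qed.

Lemma jinv_pos p : jpos p -> jpos (jinv p).
Proof. by move=> p0; have [] := jinvP (calg_ca p) (calg_id p) p0. Qed.

Lemma jinvK p : jpos p -> jinv (jinv p) = p.
Proof.
move=> p0; have [cA Ap] := (calg_ca p, calg_id p).
have [Aj j0 pj] := jinvP cA Ap p0.
by apply: (jinvE cA) => //; rewrite jmulC.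
Qed.

Lemma jpos1 : jpos 1J.
Proof. by rewrite -[1J]scale1r; exact: jpos_scal. Qed.

Lemma jinv1 : jinv 1J = 1J.
Proof.
by apply: (jinvE (calg_ca 1J) (calg_id _) (calg_id _) jpos1); rewrite jmulx1.
Qed.

Lemma jinvZ t p : 0 < t -> jpos p -> jinv (t *: p) = t^-1 *: jinv p.
Proof.
move=> t0 p0; have [cA Ap] := (calg_ca p, calg_id p).
have [Aj j0 pj] := jinvP cA Ap p0.
apply: (jinvE cA); [exact: (caZ cA)|exact: (caZ cA)|exact: jposZ|].
by rewrite !jmulE pj scalerA mulfV ?scale1r// gt_eqF.
Qed.

(** There is an exact formula,
    p^-1 - (p + v)^-1 = U_((p + v)^-1) (v + U_v (p^-1)),
    and the quadratic operators in it are positive. *)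
Lemma jinv_anti p v : jpos p -> jpos v -> jnneg (jinv p - jinv (p + v)).
Proof.
move=> p0 v0; have [cA Ap] := (calg_ca p, calg_id p).
have [Ay y0 py] := jinvP cA Ap p0; set y := jinv p in Ay y0 py *.
have pv0 : jpos (p + v) by exact: jposD.
have [cB Bp] := (calg_ca (p + v), calg_id (p + v)).
have [Bz z0 pz] := jinvP cB Bp pv0; set z := jinv (p + v) in Bz z0 pz *.
have zp : z ∘ (p + v) = 1J by rewrite jmulC.
have Uz : Uop (p + v) z = p + v.
  by rewrite (Uop_ca cB)// (ca_assoc cB)// pz jmulx1.
have Upy : p ∘ (p ∘ y) = p by rewrite py jmulx1.
have ppy : (p ∘ p) ∘ y = p by rewrite (ca_assoc cA).
have Uy : Uop (p + v) y = p + v + (v + Uop v y).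
  have C : p ∘ (v ∘ y) = (p ∘ v) ∘ y.
    by rewrite (jmulC v) (ca_opcomm cA) // jmulC.
  rewrite /Uop !jmulE !Upy ppy py !jmulE C (jmulC v p); module.
have -> : y - z = Uop z (v + Uop v y).
  rewrite -(Uop_cancel (y - z) cB Bz Bp zp) UopB Uy Uz.
  by congr Uop; module.
apply: Uop_nneg => //; apply: jpos_nneg; apply: jposD => //.
exact: Uop_pos.
Qed.

(** * Unital order automorphisms are Jordan automorphisms *)

(** The order distance of p and q, also known as the Thompson metric, is at most
    log l. *)
Definition order_close l p q := jnneg (l *: q - p) /\ jnneg (l *: p - q).

(** The second function is the inverse of the first on the open cone. *)
Record order_isometry (f f' : V -> V) : Prop := OrderIsometry {
  oi_pos : forall p, jpos p -> jpos (f p);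
  oi_pos' : forall p, jpos p -> jpos (f' p);
  oi_K : forall p, jpos p -> f' (f p) = p;
  oi_K' : forall p, jpos p -> f (f' p) = p;
  oi_close : forall l p q, 0 < l -> jpos p -> jpos q ->
    order_close l p q -> order_close l (f p) (f q);
  oi_close' : forall l p q, 0 < l -> jpos p -> jpos q ->
    order_close l p q -> order_close l (f' p) (f' q) }.

Lemma oi_sym f f' : order_isometry f f' -> order_isometry f' f.
Proof. by case. Qed.

Lemma oi_comp f f' (g g' : V -> V) : order_isometry f f' -> order_isometry g g' ->
  order_isometry (fun x => f (g x)) (fun x => g' (f' x)).
Proof.
move=> [fp fp' fK fK' fc fc'] [gp gp' gK gK' gc gc']; split => [p|p|p|p|l p q|l p q] *.
- exact/fp/gp.
- exact/gp'/fp'.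
- by rewrite fK ?gK//; exact: gp.
- by rewrite gK' ?fK'//; exact: fp'.
- by apply: fc => //; [exact: gp|exact: gp|exact: gc].
- by apply: gc' => //; [exact: fp'|exact: fp'|exact: fc'].
Qed.

Lemma oi_GOmega g : GOmega g -> order_isometry g (binv g).
Proof.
have cl h l p q : GOmega h -> order_close l p q -> order_close l (h p) (h q).
  move=> hO [pq qp]; split; rewrite -bopZ -bopN -bopD; exact: GOmega_nneg.
move=> gO; have gG := GOmega_GL gO; have bO := GOmega_binv gO.
split=> [p|p|p _|p _|l p q _ _ _|l p q _ _ _].
- by move/(GOmega_pos _ gO).
- by move/(GOmega_pos _ bO).
- exact: binvK'.
- exact: binvK.
- exact: cl.
- exact: cl.
Qed.

Lemma oi_jinv : order_isometry jinv jinv.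
Proof.
have le l p q : 0 < l -> jpos p -> jpos q -> jnneg (l *: q - p) ->
    jnneg (l *: jinv p - jinv q).
  move=> l0 p0 q0 pq; apply: (@jnneg_arch _ _ _ (jinv p)) => e e0.
  have le0 : 0 < l + e by rewrite addr_gt0.
  have -> : l *: jinv p - jinv q + e *: jinv p =
      (l + e) *: (jinv p - (l + e)^-1 *: jinv q).
    by rewrite scalerBr scalerA mulfV ?gt_eqF// scale1r; module.
  apply: jnnegZ; first exact: ltW.
  rewrite -jinvZ//; have -> : (l + e) *: q = p + (l *: q - p + e *: q) by module.
  by apply: jinv_anti => //; apply: jnneg_posD => //; exact: jposZ.
have cl l p q : 0 < l -> jpos p -> jpos q -> order_close l p q ->
    order_close l (jinv p) (jinv q).
  by move=> l0 p0 q0 [pq qp]; split; exact: le.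
by split=> //; [exact: jinv_pos|exact: jinv_pos|exact: jinvK|exact: jinvK].
Qed.

Lemma order_close_sym l p q : order_close l p q -> order_close l q p.
Proof. by case. Qed.

Lemma order_close_trans l m p q x : 0 <= l -> 0 <= m ->
  order_close l p q -> order_close m q x -> order_close (l * m) p x.
Proof.
move=> l0 m0 [pq qp] [qx xq]; split.
  have -> : (l * m) *: x - p = l *: (m *: x - q) + (l *: q - p) by module.
  by apply: jnnegD => //; exact: jnnegZ.
have -> : (l * m) *: p - x = m *: (l *: p - q) + (m *: q - x) by module.
by apply: jnnegD => //; exact: jnnegZ.
Qed.

Lemma order_close_ex p : jpos p -> exists2 l, 1 <= l & order_close l p 1J.
Proof.
move=> p0; have [cA Ap] := (calg_ca p, calg_id p).
have [Ay y0 py] := jinvP cA Ap p0; pose l := 1 + `|p| + `|jinv p|.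
exists l; first by rewrite /l -addrA lerDl addr_ge0.
split; first by apply: jnneg_ballB; rewrite /l addrAC lerDr addr_ge0.
have -> : l *: p - 1J = p ∘ (l *: 1J - jinv p) by rewrite !jmulE py.
apply: (jnneg_mul cA) => //; first by apply: (caB cA) => //; exact: (ca_scal cA).
  exact: jpos_nneg.
by apply: jnneg_ballB; rewrite /l lerDr addr_ge0.
Qed.

(** Inversion acts as the point reflection at the unit: p and its inverse are
    twice as far apart as p and the unit, because p <= l p^-1 amounts to
    p^2 <= l in the algebra of p. *)
Lemma order_close_jinv l p : 0 <= l -> jpos p -> order_close l p (jinv p) ->
  order_close (Num.sqrt l) p 1J.
Proof.
have half q : 0 <= l -> jpos q -> jnneg (l *: jinv q - q) ->
    jnneg (Num.sqrt l *: 1J - q).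
  move=> l0 q0 qj; have [cA Aq] := (calg_ca q, calg_id q).
  have [Ay y0 qy] := jinvP cA Aq q0.
  have : jnneg (q ∘ (l *: jinv q - q)).
    apply: (jnneg_mul cA) => //; last exact: jpos_nneg.
    by apply: (caB cA) => //; exact: (caZ cA).
  rewrite !jmulE qy => qq; apply: jnneg_ballB.
  rewrite -(@ler_pXn2r _ 2) ?nnegrE// sqr_sqrtr// -jnorm_sqr.
  apply: jnorm_le => //; apply: jnnegD; last exact: jnneg_sq.
  exact: jnneg_scal.
move=> l0 p0 [pj jp]; split; first exact: half.
have [cA Ap] := (calg_ca p, calg_id p); have [Ay y0 py] := jinvP cA Ap p0.
have : jnneg (p ∘ (Num.sqrt l *: 1J - jinv p)).
  apply: (jnneg_mul cA) => //; last 2 first.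
  - exact: jpos_nneg.
  - by apply: half => //; rewrite jinvK.
  by apply: (caB cA) => //; exact: (ca_scal cA).
by rewrite !jmulE py.
Qed.

Lemma order_close1_eq p q : (forall e, 0 < e -> order_close (1 + e) p q) ->
  p = q.
Proof.
move=> pq; apply/eqP; rewrite eq_sym -subr_eq0; apply/eqP/jnneg_anti.
  apply: (@jnneg_arch _ _ _ q) => e /pq[+ _].
  by congr jnneg; module.
apply: (@jnneg_arch _ _ _ p) => e /pq[_].
by congr jnneg; module.
Qed.

Lemma order_close_mono l m p q : l <= m -> jpos p -> jpos q ->
  order_close l p q -> order_close m p q.
Proof.
move=> lm p0 q0 [pq qp]; split.
  have -> : m *: q - p = (l *: q - p) + (m - l) *: q by module.
  by apply: jnnegD => //; apply: jnnegZ; [rewrite subr_ge0|exact: jpos_nneg].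
have -> : m *: p - q = (l *: p - q) + (m - l) *: p by module.
by apply: jnnegD => //; apply: jnnegZ; [rewrite subr_ge0|exact: jpos_nneg].
Qed.

(** Vaisala's proof of the Mazur-Ulam theorem: if every isometry that fixes x
    and its inverse moves the unit by at most log l, then composing with its
    conjugate by the reflection shows that the bound log (sqrt l) holds too. *)
Lemma oi_fix1 x f f' : jpos x -> order_isometry f f' -> f x = x ->
  f (jinv x) = jinv x -> f 1J = 1J.
Proof.
move=> x0 ff' fx fjx.
pose W (f f' : V -> V) :=
  [/\ order_isometry f f', f x = x & f (jinv x) = jinv x].
pose S : set R := [set l | 1 <= l /\
  forall f f', W f f' -> order_close l (f 1J) 1J].
have j0 := jinv_pos x0.
have S0 : S !=set0.
  have [l l1 xl] := order_close_ex x0; have l0 : 0 < l by exact: lt_le_trans l1.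
  exists (l * l); split; first by rewrite mulr_ege1.
  move=> g g' [gg' gx _]; apply: (@order_close_trans _ _ _ x) => //; do ?exact: ltW.
  rewrite -{1}gx; apply: (oi_close gg') => //; first exact: jpos1.
  exact: order_close_sym.
have Ssqrt l : S l -> S (Num.sqrt l).
  move=> [l1 lS]; have l0 : 0 < l by exact: lt_le_trans l1.
  split; first by rewrite -(sqrtr1 R) ler_sqrt// ltW.
  move=> g g' [gg' gx gj].
  have g'x : g' x = x by rewrite -{1}gx (oi_K gg').
  have g'j : g' (jinv x) = jinv x by rewrite -{1}gj (oi_K gg').
  have W2 : W (fun v => jinv (g' (jinv (g v)))) (fun v => g' (jinv (g (jinv v)))).
    split.
    - exact: (oi_comp oi_jinv (oi_comp (oi_sym gg') (oi_comp oi_jinv gg'))).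
    - by rewrite gx g'j jinvK.
    - by rewrite gj jinvK// g'x.
  have g10 := oi_pos gg' jpos1.
  have p1 : jpos (jinv (g 1J)) by exact: jinv_pos.
  have p2 : jpos (g' (jinv (g 1J))) by exact: (oi_pos' gg').
  have H := lS _ _ W2.
  have {}H : order_close l (g' (jinv (g 1J))) 1J.
    have := oi_close oi_jinv l0 (jinv_pos p2) jpos1 H.
    by rewrite jinvK// jinv1.
  apply: order_close_jinv => //; first exact: ltW.
  rewrite -(oi_K' gg' p1); apply: order_close_sym.
  by apply: (oi_close gg') => //; exact: jpos1.
have infS : has_inf S by split=> //; exists 1 => l [].
have i1 : 1 <= inf S by apply: lb_le_inf => // l [].
have i0 : 0 <= inf S by exact: le_trans i1.
have ilt : inf S <= 1.
  have : inf S ^+ 2 <= inf S.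
    apply: lb_le_inf => // l Sl; have [l1 _] := Sl.
    rewrite -[leRHS]sqr_sqrtr; last exact: le_trans l1.
    rewrite ler_pXn2r ?nnegrE// ge_inf//; last exact: Ssqrt.
    by case: infS.
  by rewrite expr2 ger_pMr// (lt_le_trans ltr01).
apply: order_close1_eq => e e0; have [l [l1 lS] le] := inf_adherent e0 infS.
apply: (@order_close_mono l) => //.
- by rewrite (le_trans (ltW le))// lerD2r.
- exact: (oi_pos ff' jpos1).
- exact: jpos1.
- by apply: (lS f f').
Qed.

Lemma Ubop_binv_jinv A (r v : V) : commutative_subalgebra A -> A r -> A v -> jpos r ->
  binv (Ubop r) v = jinv r ∘ jinv r ∘ v.
Proof.
move=> cA Ar Av r0; have [Aj j0 rj] := jinvP cA Ar r0.
have UG := GOmega_GL (GOmega_Ubop r0).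
rewrite -(Uop_ca cA)// -[RHS](binvK' UG) /=; congr (binv _ _).
by rewrite (Uop_cancel _ cA).
Qed.

(** Let tau be the reflection that exchanges k(x) and k(x^-1), a conjugate of
    inversion. Inversion composed with k^-1 tau k fixes x and x^-1, hence fixes
    the unit; so tau fixes the unit, which forces k(x^-1) = k(x)^-1. *)
Lemma unital_GOmega_jinv k x : GOmega k -> k 1J = 1J -> jpos x ->
  k (jinv x) = jinv (k x).
Proof.
move=> kO k1 x0; have kG := GOmega_GL kO.
set b := k x; set c := k (jinv x).
have b0 : jpos b by apply/(GOmega_pos _ kO).
have c0 : jpos c by apply/(GOmega_pos _ kO)/jinv_pos.
have [cB Bb] := (calg_ca b, calg_id b).
have [s [Bs s0 ss]] := jsqrt_exists cB Bb b0.
pose g := Ubop s; have gO := GOmega_Ubop s0; have gG := GOmega_GL gO.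
have g1 : g 1J = b by rewrite /= Uopx1.
pose e := binv g c; have e0 : jpos e by apply/(GOmega_pos _ (GOmega_binv gO)).
have [cE Ee] := (calg_ca e, calg_id e).
have [t [Et t0 tt]] := jsqrt_exists cE Ee e0.
have [r [Er r0 rr]] := jsqrt_exists cE Et t0.
have [Ej j0 rj] := jinvP cE Er r0.
have [Etj tj0 tjt] := jinvP cE Et t0.
have UO := GOmega_Ubop r0.
pose h := bcomp g (Ubop r); have hO : GOmega h by exact: GOmega_comp.
have hG := GOmega_GL hO.
have E1 : jinv t = jinv r ∘ jinv r.
  apply: (jinvE cE) => //; first exact: (caM cE).
  by rewrite -rr (ca_mulACA cE)// rj jmulx1.
have h1 : h 1J = g t by rewrite /= Uopx1 rr.
have hjt : h (jinv t) = b.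
  by rewrite -g1 /h /=; congr Uop; rewrite (Uop_ca cE Er Etj) rr tjt.
have ht : h t = c.
  by rewrite /h /= (Uop_ca cE Er Et) rr tt -[Uop s e]/(g e) binvK.
(* The point reflection that exchanges b and c. *)
pose tau v := h (jinv (binv h v)).
have tb : tau b = c by rewrite /tau -hjt binvK'// jinvK.
have tc : tau c = b by rewrite /tau -ht binvK'.
have f1 : jinv (binv k (tau (k 1J))) = 1J.
  apply: (@oi_fix1 x (fun v => jinv (binv k (tau (k v))))
    (fun v => binv k (tau (k (jinv v))))) => //.
  - have Ih := oi_GOmega hO; have Ik := oi_GOmega kO.
    have It : order_isometry tau tau.
      exact: (oi_comp Ih (oi_comp oi_jinv (oi_sym Ih))).
    exact: (oi_comp oi_jinv (oi_comp (oi_sym Ik) (oi_comp It Ik))).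
  - by rewrite tb /c binvK'// jinvK.
  - by rewrite tc /b binvK'.
have hi0 : jpos (binv h 1J) by apply/(GOmega_pos _ (GOmega_binv hO)); exact: jpos1.
have hij0 := jinv_pos hi0.
have tau1 : tau 1J = 1J.
  have tau0 : jpos (tau 1J) by apply/(GOmega_pos _ hO).
  rewrite k1 in f1; rewrite -[LHS](binvK kG) -[binv k _]jinvK ?f1 ?jinv1 ?k1//.
  by apply/(GOmega_pos _ (GOmega_binv kO)).
have m1 : binv h 1J = 1J.
  apply: order_close1_eq => d d0.
  rewrite -[1 + d]sqr_sqrtr ?addr_ge0 ?ltW//.
  have jm : jinv (binv h 1J) = binv h 1J by rewrite -{2}tau1 /tau binvK'.
  have -> : Num.sqrt (1 + d) ^+ 2 = Num.sqrt ((1 + d) ^+ 2).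
    by rewrite sqr_sqrtr ?sqrtr_sqr ?ger0_norm ?addr_ge0 ?ltW.
  apply: order_close_jinv; rewrite ?sqr_ge0// jm.
  have d2 : 0 <= (1 + d) ^+ 2 - 1 by rewrite expr2; move: d0; nra.
  split; have -> : (1 + d) ^+ 2 *: binv h 1J - binv h 1J =
      ((1 + d) ^+ 2 - 1) *: binv h 1J by module.
    by apply: jnnegZ => //; exact: jpos_nneg.
  by apply: jnnegZ => //; exact: jpos_nneg.
have gt1 : g t = 1J by rewrite -h1 -m1 binvK.
have [Bj bj0 bj] := jinvP cB Bb b0.
have tE : t = jinv b.
  have [Bsj sj0 sj] := jinvP cB Bs s0.
  rewrite -(binvK' gG t) gt1 (Ubop_binv_jinv cB)//; last exact: (ca1 cB).
  rewrite jmulx1; symmetry; apply: (jinvE cB) => //; first exact: (caM cB).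
  by rewrite -ss (ca_mulACA cB)// sj jmulx1.
rewrite -/c -(binvK gG c) -/e -tt tE /= (Uop_ca cB)//; last exact: (caM cB).
by rewrite ss -(ca_assoc cB)// bj jmul1x.
Qed.

(** An isomorphism that preserves inverses preserves squares, because these are
    rational expressions in inverses. *)
Lemma unital_GOmega_Aut k : GOmega k -> k 1J = 1J -> AutV k.
Proof.
move=> kO k1; split=> //; first exact: GOmega_GL.
have small p : jpos p -> jpos (1J - p) -> k (p ∘ p) = k p ∘ k p.
  (* The square is a rational expression in inverses:
     p - p^2 is the inverse of p^-1 + (1 - p)^-1. *)
  have id p' : jpos p' -> jpos (1J - p') ->
      jinv (jinv p' + jinv (1J - p')) = p' - p' ∘ p'.
    move=> p0 q0; have [cA Ap] := (calg_ca p', calg_id p').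
    have Aq := caB cA (ca1 cA) Ap.
    have [Ai i0 pi] := jinvP cA Ap p0; have [Aj j0 qj] := jinvP cA Aq q0.
    apply: (jinvE cA); [exact: (caD cA)| |exact: jposD|].
      by apply: (caB cA) => //; exact: (caM cA).
    have -> : p' - p' ∘ p' = p' ∘ (1J - p') by rewrite !jmulE.
    rewrite jmulDl -(ca_assoc cA)// (jmulC (jinv p')) pi jmul1x.
    rewrite [p' ∘ _]jmulC -(ca_assoc cA)// (jmulC (jinv _)) qj jmul1x.
    by rewrite subrK.
  move=> p0 q0; have kp0 : jpos (k p) by apply/(GOmega_pos _ kO).
  have kq : k (1J - p) = 1J - k p by rewrite bopD bopN k1.
  have kq0 : jpos (1J - k p) by rewrite -kq; apply/(GOmega_pos _ kO).
  have := id _ kp0 kq0; rewrite -kq -!unital_GOmega_jinv// -bopD.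
  rewrite -unital_GOmega_jinv//; last by apply: jposD; exact: jinv_pos.
  by rewrite id// bopD bopN => /addrI/oppr_inj.
have sq a : k (a ∘ a) = k a ∘ k a.
  pose t := (2 * (`|a| + 1))^-1.
  have t0 : 0 < t by rewrite invr_gt0 mulr_gt0// ltr_wpDl.
  have ta : `|t *: a| < 2^-1.
    rewrite normrZ gtr0_norm// ltr_pdivrMl ?mulr_gt0 ?ltr_wpDl//.
    by rewrite mulrAC divff// mul1r ltrDl.
  have := @small (2^-1 *: 1J + t *: a) (jpos_ball ta).
  have -> : 1J - (2^-1 *: 1J + t *: a) = 2^-1 *: 1J + (- (t *: a)).
    rewrite -{1}[1J]scale1r; have {1}-> : (1 : R) = 2^-1 + 2^-1 by field.
    by module.
  have ta' : `|- (t *: a)| < 2^-1 by rewrite normrN.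
  move=> /(_ (jpos_ball ta')); rewrite !(jmulE, bopE) !k1 => E.
  have : (t * t) *: (k (a ∘ a) - k a ∘ k a) = 0.
    move/eqP: E; rewrite -subr_eq0 => /eqP E; rewrite -[RHS]E !jmulE; module.
  move/eqP; rewrite scaler_eq0 mulf_eq0 orbb gt_eqF//= subr_eq0 => /eqP.
  by [].
move=> a b; have := sq (a + b); rewrite !(jmulE, bopE) !sq (jmulC b a) (jmulC (k b)).
rewrite !addrA => /addIr; rewrite -!addrA => /addrI.
move=> E; have : 2 *: (k (a ∘ b) - k a ∘ k b) = 0.
  by move/eqP: E; rewrite -subr_eq0 => /eqP <-; module.
by move/eqP; rewrite scaler_eq0 pnatr_eq0/= subr_eq0 => /eqP.
Qed.

End StructureGroup.

(** * The Finsler norms *)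

Section FinslerNorms.
Variables (R : realType) (V : jbAlgType R).
Implicit Types (x y z u v w a b c p q : V) (s t r e : R) (A : set V)
  (g h k H : bop V).
Local Notation "x ∘ y" := (jmul x y) (at level 40, left associativity).
Local Notation "1J" := (@jone R V).

Lemma bop_norm g v : `|g v| <= `|g| * `|v|.
Proof. exact: opnormP. Qed.

Lemma bop_norm_le g (M : R) : 0 <= M -> (forall v, `|g v| <= M * `|v|) ->
  `|g| <= M.
Proof.
move=> M0 gM; apply: opnorm_le => v v1; rewrite (le_trans (gM v))//.
by rewrite ler_piMr.
Qed.

Lemma bcomp_norm g h : `|bcomp g h| <= `|g| * `|h|.
Proof.
apply: bop_norm_le => [|v]; first exact: mulr_ge0.
by rewrite /= (le_trans (bop_norm _ _))// -mulrA ler_wpM2l// bop_norm.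
Qed.

Lemma bcompDr g h k : bcomp g (h + k) = bcomp g h + bcomp g k.
Proof. by apply: bopP => v /=; exact: bopD. Qed.
Lemma bcompNr g h : bcomp g (- h) = - bcomp g h.
Proof. by apply: bopP => v /=; exact: bopN. Qed.
Lemma bcompZr g t h : bcomp g (t *: h) = t *: bcomp g h.
Proof. by apply: bopP => v /=; exact: bopZ. Qed.
Lemma bcompDl g h k : bcomp (g + h) k = bcomp g k + bcomp h k.
Proof. by apply: bopP. Qed.
Lemma bcompNl g h : bcomp (- g) h = - bcomp g h.
Proof. by apply: bopP. Qed.

(** With q the inverse square root of g(1), the map U_q g fixes the unit, hence
    is an isometry. *)
Lemma tnormO_GOmega g v : GOmega g -> tnormO (g 1J) v = `|binv g v|.
Proof.
move=> gO; have gG := GOmega_GL gO.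
have p0 : jpos (g 1J) by apply/(GOmega_pos _ gO); exact: jpos1.
have [Aq q0 qqp] := jsqrtV_spec (proj2 (OmegaP _) p0).
have [cA Ap] := (calg_ca (g 1J), calg_id (g 1J)).
set q := jsqrtV _ in Aq q0 qqp.
have k1 : bcomp (Ubop q) g 1J = 1J by rewrite /= (Uop_ca cA).
rewrite -(GOmega_isometry _ (GOmega_comp (GOmega_Ubop q0) gO) k1) /=.
by rewrite [g (binv g v)]binvK.
Qed.

Lemma GOmega_transitive x : Omega x -> exists2 g, GOmega g & g 1J = x.
Proof.
move=> /OmegaP x0; have [s [_ s0 ss]] := jsqrt_exists (calg_ca x) (calg_id x) x0.
by exists (Ubop s); [exact: GOmega_Ubop|rewrite /= Uopx1].
Qed.

Lemma orbit_liftP x : Omega x -> GOmega (orbit_lift x) /\ orbit_lift x 1J = x.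
Proof.
move=> /GOmega_transitive[g gO g1].
by apply: (@getPex _ [set g | GOmega g /\ g 1J = x]); exists g.
Qed.

(** The norm at a point is the order norm with that point as unit, so it
    decreases when the point increases. *)
Lemma GOmega_norm_le g h (c : R) v : GOmega g -> GOmega h -> 0 <= c ->
  jnneg (c *: h 1J - g 1J) -> `|binv h v| <= c * `|binv g v|.
Proof.
move=> gO hO c0 gh; have [gG hG] := (GOmega_GL gO, GOmega_GL hO).
set r := `|binv g v|; have r0 : 0 <= r by rewrite /r.
have le w : `|binv g w| <= r -> jnneg ((c * r) *: 1J + binv h w).
  move=> wr; have -> : (c * r) *: 1J + binv h w = binv h ((c * r) *: h 1J + w).
    by rewrite bopD bopZ (binvK' hG).
  apply: (GOmega_nneg (GOmega_binv hO)).
  have -> : (c * r) *: h 1J + w = r *: (c *: h 1J - g 1J) + (r *: g 1J + w).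
    by module.
  apply: jnnegD; first exact: jnnegZ.
  rewrite -[w in X in jnneg X](binvK gG) -bopZ -bopD; apply: GOmega_nneg => //.
  exact: jnneg_ballD.
apply: jnorm_le; first exact: mulr_ge0.
  by apply: le; rewrite /r.
by rewrite -bopN; apply: le; rewrite bopN normrN.
Qed.

(** Joint continuity in the point and the vector; the structure group is not
    open in the space of operators, so the points are restricted to S. *)
Definition norm_field_continuous (E : normedModType R) (S : set E)
    (N : E -> E -> R) := forall p v : E, S p -> forall e, 0 < e ->
  exists2 d : R, 0 < d & forall p' v' : E, S p' -> `|p' - p| < d -> `|v' - v| < d ->
    `|N p' v' - N p v| < e.

(** If g(1) = p and g^-1(p') is at distance t from the unit, then
    (1 - t) p <= p' <= (1 + t) p, and the norms at p and p' compare. *)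
Lemma tnormO_continuous : norm_field_continuous (@Omega R V) (@tnormO R V).
Proof.
move=> p v pO e e0; have [g gO gp] := GOmega_transitive pO.
have gG := GOmega_GL gO; pose B := `|binv g| + 1.
have B0 : 0 < B by rewrite ltr_wpDl.
pose n := `|binv g v|; have n0 : 0 <= n by rewrite /n.
pose m := Num.min 2^-1 (e / (2 * n + 2)).
have n2 : 0 < 2 * n + 2 by rewrite ltr_wpDl ?mulr_ge0.
have m0 : 0 < m by rewrite lt_min invr_gt0 ltr0n divr_gt0.
exists (m / B); first by rewrite divr_gt0.
move=> p' v' p'O; rewrite !ltr_pdivlMr// => pp vv.
have [h hO hp] := GOmega_transitive p'O.
have small w : `|w| * B < m -> `|binv g w| < m.
  move=> wB; apply: le_lt_trans wB; rewrite (le_trans (bop_norm _ _))// mulrC.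
  by rewrite ler_wpM2l// lerDl.
set u := binv g (p' - p); set w := binv g (v' - v).
have um : `|u| < m by exact: small.
have wm : `|w| < m by exact: small.
have {pp vv} m2 : m <= 2^-1 by rewrite ge_min lexx.
have me : m * (2 * n + 2) <= e by rewrite -ler_pdivlMr// ge_min lexx orbT.
have p'E : p' = p + g u by rewrite /u binvK// addrC subrK.
set t := `|u| in um; have t0 : 0 <= t by rewrite /t.
have t1 : 0 < 1 - t by lra.
have c0 : 0 <= (1 - t)^-1 by rewrite invr_ge0 ltW.
have le1 : `|binv h v'| <= (1 - t)^-1 * `|binv g v'|.
  apply: GOmega_norm_le => //; rewrite hp gp.
  have -> : (1 - t)^-1 *: p' - p = (1 - t)^-1 *: g (t *: 1J + u).
    have {1}-> : p = (1 - t)^-1 *: ((1 - t) *: p).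
      by rewrite scalerA mulVf ?scale1r// gt_eqF.
    by rewrite bopD bopZ gp p'E; module.
  by apply: jnnegZ => //; apply: GOmega_nneg => //; exact: jnneg_ballD.
have le2 : `|binv g v'| <= (1 + t) * `|binv h v'|.
  apply: GOmega_norm_le => //; first by rewrite addr_ge0.
  have -> : (1 + t) *: g 1J - h 1J = g (t *: 1J - u).
    by rewrite hp bopD bopN bopZ gp p'E; module.
  by apply: GOmega_nneg => //; exact: jnneg_ballB.
rewrite -hp -gp !tnormO_GOmega// -/n.
have vE : binv g v' = binv g v + w by rewrite -bopD addrC subrK.
have a1 : `|binv g v'| <= n + `|w| by rewrite vE ler_normD.
have a2 : n <= `|binv g v'| + `|w|.
  by rewrite /n -[binv g v](addrK w) -vE ler_normB.
move: le1; rewrite ler_pdivlMl// => le1.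
move: (normr_ge0 w) wm le1 le2 a1 a2 (normr_ge0 (binv h v')).
set X := `|binv g v'|; set Y := `|binv h v'|; set z := `|w|.
move=> z0 zm le1 le2 a1 a2 Y0; rewrite ltr_norml.
(* Y <= 2 X since t <= 1/2, hence t Y <= 2 t X. *)
have Y2 : Y <= 2 * X.
  have : t * Y <= 2^-1 * Y by rewrite ler_wpM2r//; lra.
  lra.
have X1 : X <= n + 2^-1 by lra.
have tY : t * Y <= m * (2 * n + 1).
  by apply: ler_pM => //; lra.
by apply/andP; split; lra.
Qed.

Lemma tnormG_continuous : norm_field_continuous (@GOmega R V) (@tnormG R V).
Proof.
move=> g H gO e e0; have gG := GOmega_GL gO.
pose B := `|binv g| + 1; have B0 : 0 < B by rewrite ltr_wpDl.
have gB : `|binv g| <= B by rewrite lerDl.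
pose C := 2 * B * (1 + B * `|H|) + 1.
have C0 : 0 < C by rewrite ltr_wpDl// !mulr_ge0 ?addr_ge0 ?mulr_ge0// ltW.
pose d := Num.min (2 * B)^-1 (e / C).
have d0 : 0 < d by rewrite lt_min invr_gt0 mulr_gt0// divr_gt0.
exists d => // g' H' g'O gg HH; have g'G := GOmega_GL g'O.
have d1 : d <= (2 * B)^-1 by rewrite ge_min lexx.
have d2 : d * C <= e by rewrite -ler_pdivlMr// ge_min lexx orbT.
have invB : binv g' - binv g = bcomp (bcomp (binv g') (g - g')) (binv g).
  apply: bopP => v.
  change (binv g' v - binv g v = binv g' (g (binv g v) - g' (binv g v))).
  by rewrite (binvK gG) bopD bopN (binvK' g'G).
have nB : `|binv g' - binv g| <= `|binv g'| * d * B.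
  rewrite invB (le_trans (bcomp_norm _ _))// ler_pM//.
  rewrite (le_trans (bcomp_norm _ _))// ler_wpM2l//.
  by rewrite distrC ltW.
have g'B : `|binv g'| <= 2 * B.
  have : `|binv g'| * d * B <= `|binv g'| * 2^-1.
    rewrite -mulrA ler_wpM2l//.
    by rewrite (le_trans (ler_wpM2r (ltW B0) d1))// invfM -mulrA mulVf ?mulr1// gt_eqF.
  have := ler_normD (binv g' - binv g) (binv g); rewrite subrK; lra.
rewrite /tnormG; apply: le_lt_trans (ler_dist_dist _ _) _.
have -> : bcomp (binv g') H' - bcomp (binv g) H =
    bcomp (binv g') (H' - H) + bcomp (binv g' - binv g) H.
  by rewrite bcompDr bcompNr bcompDl bcompNl addrA subrK.
apply: le_lt_trans (ler_normD _ _) _.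
have l1 : `|bcomp (binv g') (H' - H)| <= 2 * B * d.
  by rewrite (le_trans (bcomp_norm _ _))// ler_pM// ltW.
have l2 : `|bcomp (binv g' - binv g) H| <= 2 * B * d * B * `|H|.
  rewrite (le_trans (bcomp_norm _ _))// ler_wpM2r// (le_trans nB)//.
  by rewrite ler_wpM2r ?ler_wpM2r// ltW.
apply: lt_le_trans d2; rewrite /C; move: d0 l1 l2; lra.
Qed.

(** The operator U_y is positive, so it is bounded by its value y^2 at 1. *)
Lemma Uop_norm_pos y v : jpos y -> `|Uop y v| <= `|y| ^+ 2 * `|v|.
Proof.
move=> y0; have le w : `|w| <= `|v| -> jnneg ((`|y| ^+ 2 * `|v|) *: 1J + Uop y w).
  move=> wv; have -> : (`|y| ^+ 2 * `|v|) *: 1J + Uop y w =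
      `|v| *: (`|y| ^+ 2 *: 1J - y ∘ y) + Uop y (`|v| *: 1J + w).
    by rewrite UopD UopZ Uopx1; module.
  apply: jnnegD; last by apply: Uop_nneg => //; exact: jnneg_ballD.
  by apply: jnnegZ => //; apply: jnneg_ballB; rewrite jnorm_sqr.
apply: jnorm_le; first by rewrite mulr_ge0// sqr_ge0.
  exact: le.
by rewrite -UopN; apply: le; rewrite normrN.
Qed.

(** A nearby point is reached from g(1) inside the orbit of g by the path of the
    elements g U_(1 + s w), where (1 + w)^2 = g^-1(p); to first order its speed
    2 w is the tangent vector g^-1(p) - 1. The constant comes from
    (n + 7 n^2) / (1 - n)^2 <= n (1 + 40 n) for n <= 1 / 2. *)
Lemma orbit_step g p : GOmega g -> `|binv g p - 1J| <= 2^-1 ->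
  let n := `|binv g p - 1J| in
  exists w, [/\ Uop (1J + w) 1J = binv g p,
    forall s, 0 <= s <= 1 -> jpos (1J + s *: w) &
    forall s, 0 <= s <= 1 ->
      `|bcomp (binv (Ubop (1J + s *: w))) (2 *: Lbop w + (2 * s) *: Ubop w)|
        <= n * (1 + 40 * n)].
Proof.
move=> gO n2' n; have n2 : n <= 2^-1 by [].
have gG := GOmega_GL gO; set q := binv g p; rewrite -/q in n2'.
have n0 : 0 <= n by rewrite /n.
have [cA Aq] := (calg_ca q, calg_id q).
have Au : calg q (1J - q) by apply: (caB cA) => //; exact: (ca1 cA).
have un : `|1J - q| = n by rewrite distrC.
have [|w' [Aw w'u w'2 ww]] := sqrt_near1 cA Au; first by rewrite un; lra.
have wn : `|w'| <= (n + n ^+ 2) / 2.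
  have : `|2 *: w'| <= n + n ^+ 2.
    rewrite w'2 (le_trans (ler_normD _ _))// un lerD2l jnorm_sqr.
    by rewrite ler_pXn2r ?nnegrE// -un.
  by rewrite normrZ ger0_norm// ler_pdivlMr// mulrC.
rewrite un in w'u.
have pos s : 0 <= s <= 1 -> `|s *: w'| <= n.
  move=> /andP[s0 s1]; rewrite normrZ ger0_norm// (le_trans _ w'u)//.
  by rewrite ler_piMl.
have n1 : n < 1 by rewrite (le_lt_trans n2)// invf_lt1// ltr1n.
have c0 s : 0 <= s <= 1 -> jpos (1J + s *: - w').
  move=> s01; rewrite -[X in X + _]scale1r; apply: jpos_ball.
  by rewrite scalerN normrN (le_lt_trans (pos _ s01)).
exists (- w'); split => //; first by rewrite Uopx1 ww opprB addrC subrK.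
move=> s s01; set c := 1J + _; have c1 := c0 s s01; rewrite -/c in c1.
have cE : c = 1J - s *: w' by rewrite /c scalerN.
have [|y [Ay yn cy]] := inv_near1 cA (caZ cA s Aw).
  by rewrite (le_lt_trans (pos _ s01)).
have Ac : calg q c by rewrite cE; apply: (caB cA); [exact: (ca1 cA)|exact: (caZ cA)].
rewrite -cE in cy.
have y0 : jpos y.
  by have [Aj j0 _] := jinvP cA Ac c1; rewrite -(jinvE cA Ac Ay c1 cy).
have binvU : binv (Ubop c) = Ubop y.
  apply: binv_uniq; last exact: (GOmega_GL (GOmega_Ubop c1)).
  by move=> v /=; apply: (Uop_cancel _ cA) => //; rewrite jmulC.
rewrite binvU (le_trans (bcomp_norm _ _))//.
have Uy : `|Ubop y| <= `|y| ^+ 2.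
  by apply: bop_norm_le => [|v]; [exact: sqr_ge0|exact: Uop_norm_pos].
have y1 : `|y| <= (1 - n)^-1.
  rewrite (le_trans yn)// lef_pV2 ?posrE ?subr_gt0 ?lerB ?pos//.
  by rewrite (le_lt_trans (pos _ s01)).
have Ln : `|2 *: Lbop (- w') + (2 * s) *: Ubop (- w')| <= n + 7 * n ^+ 2.
  rewrite (le_trans (ler_normD _ _))// (normrZ 2) (normrZ (2 * s)).
  have L1 : `|Lbop (- w')| <= `|w'|.
    by apply: bop_norm_le => // v; rewrite -(normrN w'); exact: jnormM.
  have U1 : `|Ubop (- w')| <= 3 * `|w'| ^+ 2.
    apply: bop_norm_le => [|v]; first by rewrite mulr_ge0// sqr_ge0.
    by rewrite -(normrN w'); exact: Uop_norm.
  have w2 : `|w'| ^+ 2 <= n ^+ 2 by rewrite ler_pXn2r ?nnegrE.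
  have [s0 s1] := andP s01.
  have s2 : `|2 * s| <= 2 by rewrite ger0_norm ?mulr_ge0// -[leRHS]mulr1 ler_wpM2l.
  have : `|2 * s| * `|Ubop (- w')| <= 2 * (3 * n ^+ 2).
    by apply: ler_pM => //; rewrite (le_trans U1)// ler_wpM2l.
  rewrite [`|2 : R|]ger0_norm// => U2.
  have L2 : 2 * `|Lbop (- w')| <= n + n ^+ 2.
    by rewrite mulrC -ler_pdivlMr// (le_trans L1).
  have -> : n + 7 * n ^+ 2 = (n + n ^+ 2) + 2 * (3 * n ^+ 2) by ring.
  exact: lerD.
have y2 : `|y| ^+ 2 <= ((1 - n)^-1) ^+ 2.
  by rewrite ler_pXn2r ?nnegrE// invr_ge0 subr_ge0 ltW.
have := ler_pM (normr_ge0 _) (normr_ge0 _) (le_trans Uy y2) Ln.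
move=> /le_trans; apply.
rewrite exprVn mulrC ler_pdivrMr ?exprn_gt0 ?subr_gt0//.
have -> : n + 7 * n ^+ 2 = n * (1 + 7 * n) by ring.
rewrite -mulrA ler_wpM2l//.
have h1 : 0 <= n * (2^-1 - n) by rewrite mulr_ge0// subr_ge0.
have h2 : 0 <= n * (n - 2^-1) ^+ 2 by rewrite mulr_ge0// sqr_ge0.
have -> : (1 + 40 * n) * (1 - n) ^+ 2 = 1 + 7 * n +
    (40 * (n * (n - 2^-1) ^+ 2) + 39 * (n * (2^-1 - n)) + 3 * 2^-1 * n).
  by field.
by rewrite lerDl !addr_ge0// mulr_ge0.
Qed.

End FinslerNorms.

(** * Piecewise C^1 paths *)

Section Paths.
Variables (R : realType) (E : normedModType R).
Implicit Types (c : R -> E) (a b m t s u e d : R) (S : set E) (N : E -> E -> R).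

Lemma dnbhsP t (P : R -> Prop) : (\forall s \near t^', P s) <->
  exists2 d, 0 < d & forall s, `|s - t| < d -> s != t -> P s.
Proof.
split=> [/nbhs_ballP[d /= d0 dP]|[d d0 dP]].
  exists d => // s st s_neq; apply: dP => //.
  by rewrite -ball_normE /= distrC.
apply/nbhs_ballP; exists d => //= s; rewrite -ball_normE /= distrC => st sn.
exact: dP.
Qed.

Lemma within_dnbhsP (A : set R) t (P : R -> Prop) :
  (\forall s \near within A t^', P s) <->
  exists2 d, 0 < d & forall s, A s -> `|s - t| < d -> s != t -> P s.
Proof.
rewrite near_withinE; split=> [/dnbhsP[d d0 dP]|[d d0 dP]].
  by exists d => // s As sd sn; exact: dP.
by apply/dnbhsP; exists d => // s sd sn As; exact: dP.
Qed.

Lemma nbhs_withinP (A : set R) t (P : R -> Prop) :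
  (\forall s \near within A (nbhs t), P s) <->
  exists2 d, 0 < d & forall s, A s -> `|s - t| < d -> P s.
Proof.
rewrite near_withinE; split=> [/nbhs_ballP[d /= d0 dP]|[d d0 dP]].
  by exists d => // s As st; apply: dP => //; rewrite -ball_normE /= distrC.
apply/nbhs_ballP; exists d => //= s; rewrite -ball_normE /= distrC => st As.
exact: dP.
Qed.

Lemma within_continuousP (F : normedModType R) (A : set R) (f : R -> F) :
  {within A, continuous f} <->
  forall t, A t -> forall e, 0 < e -> exists2 d, 0 < d &
    forall s, A s -> `|s - t| < d -> `|f s - f t| < e.
Proof.
split=> [/subspace_continuousP fc t At e e0|fc].
  have /cvgrPdist_lt/(_ e e0)/nbhs_withinP[d d0 dP] := fc t At.
  by exists d => // s As st; rewrite distrC; exact: dP.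
apply/subspace_continuousP => t At; apply/cvgrPdist_lt => e e0.
apply/nbhs_withinP; have [d d0 dP] := fc t At e e0.
by exists d => // s As st; rewrite distrC; exact: dP.
Qed.

Definition slope c t s : E := (s - t)^-1 *: (c s - c t).

Lemma slopeC c t s : slope c t s = slope c s t.
Proof.
by rewrite /slope -(opprB t s) invrN scaleNr -scalerN opprB.
Qed.

Lemma derive1_slope c t (v : E) : slope c t s @[s --> t^'] --> v ->
  derive1 c t = v.
Proof.
move=> ct; apply: cvg_lim; first exact: norm_hausdorff.
apply/cvgrPdist_lt => e e0; apply/dnbhsP.
have /cvgrPdist_lt/(_ e e0)/dnbhsP[d d0 dP] := ct.
exists d => // h; rewrite subr0 => hd h0.
have := dP (h + t); rewrite /slope addrK; apply => //.
by rewrite -subr_eq0 addrK.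
Qed.

Lemma derive1_eq_itv c c2 a b t : {in `]a, b[, c =1 c2} -> t \in `]a, b[ ->
  derive1 c t = derive1 c2 t.
Proof.
move=> cc tab; rewrite !derive1E; apply: near_eq_derive.
by have := near_in_itvoo tab; apply: filterS => s /cc.
Qed.

Lemma itv_partition_split (x b a : R) (s : seq R) : itv_partition a b (x :: s) ->
  [/\ a < x, itv_partition x b s & s != [::] -> x < b].
Proof.
move=> abs; have [/= /andP[ax _] _] := abs; have xb := itv_partition_cons abs.
split=> // s0; apply: (itv_partition_size_neq0 _ xb).
by rewrite lt0n size_eq0.
Qed.

Lemma piecewise_C1_ind c (P : R -> R -> Prop) :
  (forall a b, a < b -> C1_on c a b -> P a b) ->
  (forall a m b, a < m -> m < b -> P a m -> P m b -> P a b) ->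
  forall a b, a < b -> piecewise_C1 c a b -> P a b.
Proof.
move=> PC Pcat a b ab [s]; elim: s a ab => [a ab /itv_partition_nil abE|x s IH a ab].
  by move: ab; rewrite abE ltxx.
move=> /itv_partition_split[ax xbs xb] cs.
have c0 : C1_on c a x by exact: (cs 0%N).
have [s0|s0] := eqVneq s [::].
  by move: xbs c0; rewrite s0 => /itv_partition_nil -> /PC; exact.
apply: (Pcat _ x) => //; [exact: xb|exact: PC|].
apply: IH => //; first exact: xb.
by move=> i si; exact: (cs i.+1).
Qed.

Lemma C1_piecewise c a b : a < b -> C1_on c a b -> piecewise_C1 c a b.
Proof.
move=> ab cC; exists [:: b]; first exact: itv_partition1.
by case.
Qed.

Lemma piecewise_C1_cat c a m b : a < m -> piecewise_C1 c a m ->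
  piecewise_C1 c m b -> piecewise_C1 c a b.
Proof.
move=> am cam; move: b; pattern a, m; move: a m am cam.
apply: piecewise_C1_ind => [a m am cC b|a n m _ _ IH1 IH2 b /IH2/IH1//].
move=> [s [ms sb] cs]; exists (m :: s); first by split=> //=; rewrite am.
by case.
Qed.

Lemma C1_on_ext c c2 a b : {in `[a, b], c =1 c2} -> C1_on c a b -> C1_on c2 a b.
Proof.
move=> cc [c' [c'c cd]]; exists c'; split=> // t tab.
apply: cvg_trans (cd t tab); apply: near_eq_cvg; apply/within_dnbhsP.
by exists 1 => // s sab _ _; rewrite !cc.
Qed.

Lemma piecewise_C1_ext c c2 a b : a < b -> {in `[a, b], c =1 c2} ->
  piecewise_C1 c a b -> piecewise_C1 c2 a b.
Proof.
move=> ab + cab; pattern a, b; move: a b ab cab.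
apply: piecewise_C1_ind => [a b ab cC cc|a m b am mb IH1 IH2 cc].
  by apply: C1_piecewise => //; exact: C1_on_ext cC.
apply: (@piecewise_C1_cat _ _ m) => //.
  apply: IH1 => t; rewrite in_itv /= => /andP[ta tm]; apply: cc.
  by rewrite in_itv /= ta (le_trans tm)// ltW.
apply: IH2 => t; rewrite in_itv /= => /andP[ta tm]; apply: cc.
by rewrite in_itv /= tm (le_trans _ ta)// ltW.
Qed.

Lemma C1_on_slope c c' a b t : t \in `]a, b[ ->
  slope c t s @[s --> within `[a, b] t^'] --> c' t ->
  slope c t s @[s --> t^'] --> c' t.
Proof.
rewrite in_itv /= => /andP[at_ tb] ct; apply/cvgrPdist_lt => e e0.
have /cvgrPdist_lt/(_ e e0)/within_dnbhsP[d d0 dP] := ct.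
apply/dnbhsP; exists (Num.min d (Num.min (t - a) (b - t))).
  by rewrite !lt_min d0 !subr_gt0 at_.
move=> s; rewrite !lt_min => /and3P[sd sa sb] sn; apply: dP => //.
rewrite /= in_itv /=; move: sa sb; rewrite !ltr_norml => /andP[? ?] /andP[? ?].
by apply/andP; split; lra.
Qed.

Section NormField.
Variables (S : set E) (N : E -> E -> R).
Hypothesis Nc : norm_field_continuous S N.

Definition speed c t : R := N (c t) (derive1 c t).

Section C1Piece.
Variables (c c' : R -> E) (a b : R).
Hypothesis ab : a < b.
Hypothesis c'c : {within `[a, b], continuous c'}.
Hypothesis cd : forall t, t \in `[a, b] ->
  slope c t s @[s --> within `[a, b] t^'] --> c' t.
Hypothesis cS : forall t, t \in `[a, b] -> S (c t).

Lemma C1_derive1 t : t \in `]a, b[ -> derive1 c t = c' t.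
Proof.
move=> tab; apply: derive1_slope; apply: (C1_on_slope tab); apply: cd.
exact: subset_itv_oo_cc.
Qed.

Lemma C1_slope_lt t e : t \in `[a, b] -> 0 < e -> exists2 d, 0 < d &
  forall s, s \in `[a, b] -> `|s - t| < d -> s != t -> `|slope c t s - c' t| < e.
Proof.
move=> tab e0; have /cvgrPdist_lt/(_ e e0)/within_dnbhsP[d d0 dP] := cd tab.
by exists d => // s sab st sn; rewrite distrC; exact: dP.
Qed.

Lemma C1_continuous t e : t \in `[a, b] -> 0 < e -> exists2 d, 0 < d &
  forall s, s \in `[a, b] -> `|s - t| < d -> `|c s - c t| < e.
Proof.
move=> tab e0; have [d d0 dP] := C1_slope_lt tab ltr01.
have M0 : 0 < `|c' t| + 1 by rewrite ltr_wpDl.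
exists (Num.min d (e / (`|c' t| + 1))); first by rewrite lt_min d0 divr_gt0.
move=> s sab; rewrite lt_min => /andP[sd].
have [->|sn] := eqVneq s t; first by rewrite !subrr !normr0.
rewrite ltr_pdivlMr// => se.
have -> : c s - c t = (s - t) *: slope c t s.
  by rewrite /slope scalerA mulfV ?scale1r// subr_eq0.
rewrite normrZ (le_lt_trans _ se)// ler_wpM2l//.
have := dP s sab sd sn; have := ler_normD (slope c t s - c' t) (c' t).
by rewrite subrK; lra.
Qed.

Lemma C1_speed_continuous t e : t \in `[a, b] -> 0 < e -> exists2 d, 0 < d &
  forall s, s \in `[a, b] -> `|s - t| < d ->
    `|N (c s) (c' s) - N (c t) (c' t)| < e.
Proof.
move=> tab e0; have [d d0 dN] := Nc (c' t) (cS tab) e0.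
have [d1 d10 d1P] := C1_continuous tab d0.
have [d2 d20 d2P] := proj1 (within_continuousP _ _) c'c t tab d d0.
exists (Num.min d1 d2); first by rewrite lt_min d10.
move=> s sab; rewrite lt_min => /andP[s1 s2].
by apply: dN; [exact: cS|exact: d1P|exact: d2P].
Qed.

Lemma C1_speed_measurable :
  measurable_fun `[a, b]%classic (EFin \o speed c).
Proof.
apply/measurable_EFinP.
have mg : measurable_fun (`[a, b] : set R) (fun t => N (c t) (c' t)).
  apply: subspace_continuous_measurable_fun => //.
  apply/within_continuousP => t tab e e0; exact: C1_speed_continuous.
have mo : measurable_fun (`]a, b[ : set R) (speed c).
  apply: (eq_measurable_fun (fun t => N (c t) (c' t))).
    by move=> t; rewrite inE /= => tab; rewrite /speed C1_derive1.
  by apply: measurable_funS mg => //; exact: subset_itv_oo_cc.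
have -> : `[a, b]%classic = `]a, b[ `|` ([set a] `|` [set b]) :> set R.
  apply/seteqP; split=> t /=; rewrite !in_itv /=.
    move=> /andP[]; rewrite le_eqVlt => /predU1P[->|at_]; first by right; left.
    rewrite le_eqVlt => /predU1P[->|tb]; first by right; right.
    by left; rewrite at_ tb.
  move=> [/andP[? ?]|[->|->]]; first by rewrite !ltW.
    by rewrite lexx ltW.
  by rewrite lexx ltW.
apply/measurable_funU => //; first by apply: measurableU.
split=> //; apply/measurable_funU => //; split; exact: measurable_fun_set1.
Qed.

(** The norm of a chord is considered at both of its end points, since a step
    that ends at t is measured at its starting point. *)
Lemma C1_speed_limit t e : t \in `[a, b] -> 0 < e -> exists2 d, 0 < d &
  forall s, s \in `]a, b[ -> `|s - t| < d -> s != t ->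
    [/\ `|N (c t) (slope c t s) - N (c t) (c' t)| < e,
        `|N (c s) (slope c t s) - N (c t) (c' t)| < e &
        `|speed c s - N (c t) (c' t)| < e].
Proof.
move=> tab e0; have [d d0 dN] := Nc (c' t) (cS tab) e0.
have [d1 d10 d1P] := C1_continuous tab d0.
have [d2 d20 d2P] := C1_slope_lt tab d0.
have [d3 d30 d3P] := C1_speed_continuous tab e0.
exists (Num.min d1 (Num.min d2 d3)); first by rewrite !lt_min d10 d20.
move=> s sab; rewrite !lt_min => /and3P[s1 s2 s3] sn.
have sab' : s \in `[a, b] by exact: subset_itv_oo_cc.
split.
- apply: dN; [exact: cS|by rewrite subrr normr0|exact: d2P].
- apply: dN; [exact: cS|exact: d1P|exact: d2P].
- rewrite /speed C1_derive1//; exact: d3P.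
Qed.

End C1Piece.

Lemma speed_measurable c a b : a < b -> piecewise_C1 c a b ->
  (forall t, t \in `[a, b] -> S (c t)) ->
  measurable_fun `[a, b]%classic (EFin \o speed c).
Proof.
move=> ab cab; pattern a, b; move: a b ab cab; apply: piecewise_C1_ind.
  by move=> a b ab [c' [c'c cd]] cS; exact: (C1_speed_measurable ab c'c cd cS).
move=> a m b am mb IH1 IH2 cS.
have -> : `[a, b]%classic = `[a, m] `|` `[m, b] :> set R.
  apply/seteqP; split=> t /=; rewrite !in_itv /=.
    move=> /andP[at_ tb]; have [tm|mt] := leP t m; [left|right].
      by rewrite at_.
    by rewrite (ltW mt).
  move=> [/andP[? tm]|/andP[mt ?]]; apply/andP; split=> //.
    by rewrite (le_trans tm)// ltW.
  by rewrite (le_trans _ mt)// ltW.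
apply/measurable_funU => //; split.
  apply: IH1 => t; rewrite in_itv /= => /andP[ta tm]; apply: cS.
  by rewrite in_itv /= ta (le_trans tm)// ltW.
apply: IH2 => t; rewrite in_itv /= => /andP[ta tm]; apply: cS.
by rewrite in_itv /= tm (le_trans _ ta)// ltW.
Qed.

Definition chord_speed c t s phi e :=
  [/\ `|N (c t) (slope c t s) - phi| < e,
      `|N (c s) (slope c t s) - phi| < e & `|speed c s - phi| < e].

Lemma speed_right c a b : a < b -> piecewise_C1 c a b ->
  (forall t, t \in `[a, b] -> S (c t)) ->
  forall t, a <= t < b -> exists phi, forall e, 0 < e -> exists2 d, 0 < d &
    forall s, t < s < t + d -> chord_speed c t s phi e.
Proof.
move=> ab cab; pattern a, b; move: a b ab cab; apply: piecewise_C1_ind.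
  move=> a b ab [c' [c'c cd]] cS t /andP[at_ tb]; exists (N (c t) (c' t)).
  move=> e e0; have tab : t \in `[a, b] by rewrite in_itv /= at_ ltW.
  have [d d0 dP] := C1_speed_limit c'c cd cS tab e0.
  exists (Num.min d (b - t)); first by rewrite lt_min d0 subr_gt0.
  move=> s /andP[ts]; rewrite -ltrBlDl lt_min => /andP[sd sb].
  apply: dP; last by rewrite gt_eqF.
    by rewrite in_itv /=; apply/andP; split; lra.
  by rewrite gtr0_norm// subr_gt0.
move=> a m b am mb IH1 IH2 cS t /andP[at_ tb].
have [tm|mt] := ltP t m.
  apply: IH1 => [s|]; last by rewrite at_.
  rewrite in_itv /= => /andP[ta sm]; apply: cS.
  by rewrite in_itv /= ta (le_trans sm)// ltW.
apply: IH2 => [s|]; last by rewrite mt.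
rewrite in_itv /= => /andP[ta sm]; apply: cS.
by rewrite in_itv /= sm (le_trans _ ta)// ltW.
Qed.

Lemma speed_left c a b : a < b -> piecewise_C1 c a b ->
  (forall t, t \in `[a, b] -> S (c t)) ->
  forall t, a < t <= b -> exists phi, forall e, 0 < e -> exists2 d, 0 < d &
    forall s, t - d < s < t -> chord_speed c t s phi e.
Proof.
move=> ab cab; pattern a, b; move: a b ab cab; apply: piecewise_C1_ind.
  move=> a b ab [c' [c'c cd]] cS t /andP[at_ tb]; exists (N (c t) (c' t)).
  move=> e e0; have tab : t \in `[a, b] by rewrite in_itv /= tb ltW.
  have [d d0 dP] := C1_speed_limit c'c cd cS tab e0.
  exists (Num.min d (t - a)); first by rewrite lt_min d0 subr_gt0.
  move=> s /andP[+ ts]; rewrite ltrBlDr -ltrBlDl lt_min => /andP[sd sb].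
  apply: dP; last by rewrite lt_eqF.
    by rewrite in_itv /=; apply/andP; split; lra.
  by rewrite distrC gtr0_norm// subr_gt0.
move=> a m b am mb IH1 IH2 cS t /andP[at_ tb].
have [tm|mt] := leP t m.
  apply: IH1 => [s|]; last by rewrite at_.
  rewrite in_itv /= => /andP[ta sm]; apply: cS.
  by rewrite in_itv /= ta (le_trans sm)// ltW.
apply: IH2 => [s|]; last by rewrite mt.
rewrite in_itv /= => /andP[ta sm]; apply: cS.
by rewrite in_itv /= sm (le_trans _ ta)// ltW.
Qed.

End NormField.

Lemma piecewise_C1_slope c a b : a < b -> piecewise_C1 c a b ->
  exists l : seq R, forall t, t \in `[a, b] -> t \notin l ->
    exists v : E, slope c t s @[s --> t^'] --> v.
Proof.
move=> ab cab; pattern a, b; move: a b ab cab; apply: piecewise_C1_ind.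
  move=> a b ab [c' [c'c cd]]; exists [:: a; b] => t.
  rewrite in_itv /= !inE negb_or => /andP[at_ tb] /andP[ta tb'].
  have tab : t \in `]a, b[ by rewrite in_itv /= !lt_neqAle at_ tb tb' eq_sym ta.
  by exists (c' t); apply: (C1_on_slope tab); apply: cd; exact: subset_itv_oo_cc.
move=> a m b am mb [l1 H1] [l2 H2]; exists (l1 ++ l2) => t.
rewrite in_itv /= mem_cat negb_or => /andP[at_ tb] /andP[t1 t2].
have [tm|mt] := leP t m.
  by apply: H1 => //; rewrite in_itv /= at_.
by apply: H2 => //; rewrite in_itv /= tb ltW.
Qed.

End Paths.

(** * Lengths *)

Section PathLength.
Variables (R : realType) (E : normedModType R).
Implicit Types (c : R -> E) (a b m t s u e d K : R).
Variable N : E -> E -> R.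
Hypothesis N0 : forall p v, 0 <= N p v.

Let L := path_length N.

Lemma path_length_cat c a m b : a < m -> m < b ->
  measurable_fun `[a, b]%classic (EFin \o speed N c) ->
  L c a b = (L c a m + L c m b)%E.
Proof.
move=> am mb mc; rewrite /L /path_length.
have abE : `[a, b]%classic = `[a, m] `|` `]m, b] :> set R.
  by rewrite -itv_bndbnd_setU// bnd_simp ltW.
rewrite abE in mc *; rewrite ge0_integral_setU//.
- congr (_ + _)%E; rewrite integral_itv_obnd_cbnd//.
  by move: mc; apply: measurable_funS => //; exact: measurableU.
- by move=> t _; rewrite lee_fin.
- apply/disj_setPS => t [] /=; rewrite !in_itv /= => /andP[_ tm] /andP[mt _].
  by move: (lt_le_trans mt tm); rewrite ltxx.
Qed.

Lemma path_length_ext c c2 a b : {in `[a, b], c =1 c2} ->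
  measurable_fun `[a, b]%classic (EFin \o speed N c) -> L c a b = L c2 a b.
Proof.
move=> cc mc; have sE t : t \in `]a, b[ -> speed N c t = speed N c2 t.
  move=> tab; rewrite /speed; congr N.
    by apply: cc; exact: subset_itv_oo_cc.
  apply: derive1_eq_itv tab => s sab; apply: cc; exact: subset_itv_oo_cc.
have mo : measurable_fun `]a, b[%classic (EFin \o speed N c).
  by apply: measurable_funS mc => //; exact: subset_itv_oo_cc.
rewrite /L /path_length integral_itv_bndoo// [RHS]integral_itv_bndoo.
  by apply: eq_integral => t; rewrite inE /= => /sE; rewrite /speed => ->.
apply: eq_measurable_fun mo => t; rewrite inE /= => /sE.
by rewrite /speed => ->.
Qed.

Lemma path_length_le_const c a b K : a < b -> 0 <= K ->
  measurable_fun `[a, b]%classic (EFin \o speed N c) ->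
  (forall t, t \in `]a, b[ -> speed N c t <= K) ->
  (L c a b <= (K * (b - a))%:E)%E.
Proof.
move=> ab K0 mc cK; have mo : measurable_fun `]a, b[%classic (EFin \o speed N c).
  by apply: measurable_funS mc => //; exact: subset_itv_oo_cc.
rewrite /L /path_length integral_itv_bndoo//.
have <- : (\int[lebesgue_measure]_(t in `]a, b[) (cst K%:E) t = (K * (b - a))%:E)%E.
  by rewrite integral_cst//= lebesgue_measure_itv /= lte_fin ab EFinM EFinB.
by apply: ge0_le_integral => // t tab; rewrite lee_fin; first [exact: cK|exact: K0|exact: N0].
Qed.

Lemma path_length_ge_const c a b K : a < b -> 0 <= K ->
  measurable_fun `[a, b]%classic (EFin \o speed N c) ->
  (forall t, t \in `]a, b[ -> K <= speed N c t) ->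
  ((K * (b - a))%:E <= L c a b)%E.
Proof.
move=> ab K0 mc cK; have mo : measurable_fun `]a, b[%classic (EFin \o speed N c).
  by apply: measurable_funS mc => //; exact: subset_itv_oo_cc.
rewrite /L /path_length integral_itv_bndoo//.
have <- : (\int[lebesgue_measure]_(t in `]a, b[) (cst K%:E) t = (K * (b - a))%:E)%E.
  by rewrite integral_cst//= lebesgue_measure_itv /= lte_fin ab EFinM EFinB.
by apply: ge0_le_integral => // t tab; rewrite lee_fin; first [exact: cK|exact: K0|exact: N0].
Qed.

End PathLength.

(** Cousin's lemma: the supremum of the right end points that can be reached from
    a is itself reached, by the left condition, and equals b, by the right one. *)
Lemma interval_induction (R : realType) (P : R -> R -> Prop) (a b : R) : a < b ->
  (forall u m v, a <= u -> u < m -> m < v -> v <= b -> P u m -> P m v -> P u v) ->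
  (forall t, a <= t < b -> exists2 d, 0 < d &
     forall v, t < v < t + d -> v <= b -> P t v) ->
  (forall t, a < t <= b -> exists2 d, 0 < d &
     forall u, t - d < u < t -> a <= u -> P u t) -> P a b.
Proof.
move=> ab Ptrans Pr Pl; pose S : set R := [set t | a < t <= b /\ P a t].
have S0 : S !=set0.
  have [|d d0 Pd] := Pr a; first by rewrite lexx.
  have m0 : 0 < Num.min d (b - a) by rewrite lt_min d0 subr_gt0.
  have md : Num.min d (b - a) <= d by rewrite ge_min lexx.
  have mb : Num.min d (b - a) <= b - a by rewrite ge_min lexx orbT.
  exists (a + Num.min d (b - a) / 2).
  by split; [|apply: Pd]; [apply/andP; split| apply/andP; split|]; lra.
have supS : has_sup S by split=> //; exists b => t [/andP[]].
have sb : sup S <= b by apply: ge_sup => // t [/andP[]].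
have sa : a < sup S.
  have [t St] := S0; have [/andP[at_ _] _] := St.
  by rewrite (lt_le_trans at_)// ub_le_sup//; case: supS.
have Ps : P a (sup S).
  have [|d d0 Pd] := Pl (sup S); first by rewrite sa.
  have [t St ts] := sup_adherent d0 supS; have [/andP[at_ _] Pt] := St.
  have : t <= sup S by rewrite ub_le_sup//; case: supS.
  rewrite le_eqVlt => /predU1P[<-//|tls].
  apply: (Ptrans _ t) => //; apply: Pd; last exact: ltW.
  by rewrite ts.
move: sb; rewrite le_eqVlt => /predU1P[<-//|slb].
have [|d d0 Pd] := Pr (sup S); first by rewrite slb ltW.
pose v := sup S + Num.min d (b - sup S) / 2.
have m0 : 0 < Num.min d (b - sup S) by rewrite lt_min d0 subr_gt0.
have md : Num.min d (b - sup S) <= d by rewrite ge_min lexx.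
have mb : Num.min d (b - sup S) <= b - sup S by rewrite ge_min lexx orbT.
have sv : sup S < v by rewrite /v; lra.
have vb : v <= b by rewrite /v; lra.
have Sv : S v.
  split; first by rewrite (lt_trans sa sv).
  apply: (Ptrans _ (sup S)) => //; apply: Pd => //.
  by rewrite sv /v; lra.
by have : v <= sup S; [rewrite ub_le_sup//; case: supS|rewrite leNgt sv].
Qed.

(** * Projecting and lifting paths *)

Section OrbitPaths.
Variables (R : realType) (V : jbAlgType R).
Implicit Types (g h k H : bop V) (x y p v : V) (a b t s u e d : R).
Local Notation "1J" := (@jone R V).

Lemma tnormO_ge0 p v : 0 <= tnormO p v. Proof. by rewrite /tnormO. Qed.
Lemma tnormG_ge0 g H : 0 <= tnormG g H. Proof. by rewrite /tnormG. Qed.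

Lemma cvg_bop_eval (T : Type) (F : set_system T) (FF : Filter F)
  (f : T -> bop V) g v : f @ F --> g -> f x v @[x --> F] --> g v.
Proof.
move=> fg; apply/cvgrPdist_le => e e0.
have M0 : 0 < `|v| + 1 by rewrite ltr_wpDl.
have /cvgrPdist_le/(_ _ (divr_gt0 e0 M0)) := fg; apply: filterS => t gt.
have -> : g v - f t v = (g - f t) v by [].
rewrite (le_trans (bop_norm _ _))//.
rewrite -(@ler_pM2r _ (`|v| + 1)) // in gt; rewrite mulfVK ?gt_eqF// in gt.
by apply: le_trans gt; rewrite ler_wpM2l// lerDl.
Qed.

Lemma C1_on_eval (al : R -> bop V) a b : C1_on al a b ->
  C1_on (fun t => al t 1J) a b.
Proof.
move=> [c' [c'c cd]]; exists (fun t => c' t 1J); split=> [|t tab].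
  move: c'c => /subspace_continuousP c'c; apply/subspace_continuousP => t tab.
  by apply: cvg_bop_eval; exact: c'c.
exact: (@cvg_bop_eval _ _ _ _ _ 1J (cd t tab)).
Qed.

Lemma piecewise_C1_eval (al : R -> bop V) a b : a < b -> piecewise_C1 al a b ->
  piecewise_C1 (fun t => al t 1J) a b.
Proof.
move=> ab cab; pattern a, b; move: a b ab cab; apply: piecewise_C1_ind.
  by move=> a b ab /C1_on_eval; exact: C1_piecewise.
by move=> a m b am mb; exact: piecewise_C1_cat.
Qed.

Lemma bop1_norm g : `|g 1J| <= `|g|.
Proof.
by rewrite (le_trans (bop_norm _ _))// ler_piMr// jone_norm_le1.
Qed.

Lemma Omega_GOmega1 g : GOmega g -> Omega (g 1J).
Proof. by move=> gO; apply/OmegaP/(GOmega_pos _ gO); exact: jpos1. Qed.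

(** The orbit map shortens paths: the velocity at a point g(1) of the projected
    path has norm |(g^-1 H) 1| <= |g^-1 H|. *)
Lemma path_length_orbit (al : R -> bop V) g h a b :
  path_in (@GOmega R V) g h al a b ->
  path_in (@Omega R V) (g 1J) (h 1J) (fun t => al t 1J) a b /\
  (path_length (@tnormO R V) (fun t => al t 1J) a b <=
   path_length (@tnormG R V) al a b)%E.
Proof.
move=> [ab alC alS ala alb]; have gaC := piecewise_C1_eval ab alC.
have gaS t : t \in `[a, b] -> Omega (al t 1J).
  by move=> /alS; exact: Omega_GOmega1.
split; first by split=> //; rewrite ?ala ?alb.
have [l lP] := piecewise_C1_slope ab alC.
apply: ae_ge0_le_integral => //.
- by move=> t _; rewrite lee_fin tnormO_ge0.
- exact: (speed_measurable (@tnormO_continuous R V) ab gaC gaS).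
- by move=> t _; rewrite lee_fin tnormG_ge0.
- exact: (speed_measurable (@tnormG_continuous R V) ab alC alS).
exists [set` l]; split.
- exact/countable_measurable/finite_set_countable/finite_seq.
- exact/countable_lebesgue_measure0/finite_set_countable/finite_seq.
move=> t /= /not_implyP[tab N]; apply: contrapT => /negP tl; apply: N.
have [H tH] := lP t tab tl.
rewrite lee_fin (derive1_slope tH) (@derive1_slope _ _ _ _ (H 1J)); last first.
  exact: (@cvg_bop_eval _ _ _ _ _ 1J tH).
rewrite tnormO_GOmega; last exact: alS.
exact: (bop1_norm (bcomp (binv (al t)) H)).
Qed.

Lemma quadratic_slope (A0 A1 A2 : bop V) u e t :
  let be t := A0 + ((t - u) / e) *: A1 + ((t - u) / e) ^+ 2 *: A2 in
  forall s, s != t -> slope be t s =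
    e^-1 *: (A1 + ((s - u) / e + (t - u) / e) *: A2).
Proof.
move=> be s st; have st0 : s - t != 0 by rewrite subr_eq0.
rewrite /slope; have -> : be s - be t =
    (s - t) *: (e^-1 *: (A1 + ((s - u) / e + (t - u) / e) *: A2)).
  by rewrite /be; module.
by rewrite scalerA mulVf// scale1r.
Qed.

Lemma quadratic_C1 (A0 A1 A2 : bop V) u e :
  let be t := A0 + ((t - u) / e) *: A1 + ((t - u) / e) ^+ 2 *: A2 in
  let be' t := e^-1 *: (A1 + (2 * ((t - u) / e)) *: A2) in
  (forall t, slope be t s @[s --> t^'] --> be' t) /\
  forall a b, C1_on be a b.
Proof.
move=> be be'; have sl t : slope be t s @[s --> t^'] --> be' t.
  have : e^-1 *: (A1 + ((s - u) / e + (t - u) / e) *: A2) @[s --> t^'] --> be' t.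
    rewrite /be' (_ : 2 * ((t - u) / e) = (t - u) / e + (t - u) / e); last by ring.
    apply: cvgZ; first exact: cvg_cst.
    apply: cvgD; first exact: cvg_cst.
    apply: cvgZ; last exact: cvg_cst.
    apply: cvgD; last exact: cvg_cst.
    apply: cvgM; last exact: cvg_cst.
    apply: cvgB; last exact: cvg_cst.
    apply/cvgrPdist_lt => d d0; apply/dnbhsP; exists d => // s sd _.
    by rewrite distrC.
  apply: cvg_trans; apply: near_eq_cvg; apply/dnbhsP; exists 1 => // s _ st.
  by rewrite quadratic_slope.
split=> // a b; exists be'; split=> [|t tab].
  apply: continuous_subspaceT => t; rewrite /be'.
  apply: cvgZ; first exact: cvg_cst.
  apply: cvgD; first exact: cvg_cst.
  apply: cvgZ; last exact: cvg_cst.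
  apply: cvgM; first exact: cvg_cst.
  apply: cvgM; last exact: cvg_cst.
  by apply: cvgB; [exact: cvg_id|exact: cvg_cst].
by apply: cvg_trans (sl t); apply: cvg_app; exact: cvg_within.
Qed.

Lemma bcomp_Ubop_affine g w s : bcomp g (Ubop (1J + s *: w)) =
  g + s *: bcomp g (2 *: Lbop w) + s ^+ 2 *: bcomp g (Ubop w).
Proof.
apply: bopP => x.
change (g (Uop (1J + s *: w) x) =
  g x + s *: g (2 *: jmul w x) + s ^+ 2 *: g (Uop w x)).
rewrite -!bopZ -!bopD; congr (bop_fun g _).
by rewrite /Uop !jmulE; module.
Qed.

(** The path of [orbit_step], rescaled to [u, b]. *)
Lemma orbit_step_path g p u b : u < b -> GOmega g -> `|binv g p - 1J| <= 2^-1 ->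
  exists be : R -> bop V, [/\ path_in (@GOmega R V) g (be b) be u b,
    be b 1J = p & (path_length (@tnormG R V) be u b <=
      (`|binv g p - 1J| * (1 + 40 * `|binv g p - 1J|))%:E)%E].
Proof.
move=> ub gO gp; have [w [wp wpos wn]] := orbit_step gO gp.
set n := `|binv g p - 1J| in gp wn *; set K := n * _ in wn *.
have gG := GOmega_GL gO; have e0 : 0 < b - u by rewrite subr_gt0.
pose s t := (t - u) / (b - u).
have s01 t : t \in `[u, b] -> 0 <= s t <= 1.
  rewrite in_itv /= => /andP[ut tb]; rewrite divr_ge0 ?subr_ge0//; last exact: ltW.
  by rewrite ler_pdivrMr// mul1r lerD2r.
pose A1 := bcomp g (2 *: Lbop w); pose A2 := bcomp g (Ubop w).
pose be t : bop V := g + s t *: A1 + s t ^+ 2 *: A2.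
have beE t : be t = bcomp g (Ubop (1J + s t *: w)) by rewrite bcomp_Ubop_affine.
have [sl C1] := quadratic_C1 g A1 A2 u (b - u).
have beG t : t \in `[u, b] -> GOmega (be t).
  by move=> /s01/wpos c0; rewrite beE; apply: GOmega_comp => //; exact: GOmega_Ubop.
have beC : piecewise_C1 be u b by apply: C1_piecewise => //; exact: C1.
have be1 : be b 1J = p.
  rewrite beE /s divff ?gt_eqF// scale1r -[RHS](binvK gG) -wp.
  by [].
exists be; split => //.
  by split => //; rewrite /be /s subrr mul0r scale0r expr0n scale0r !addr0.
have K0 : 0 <= K by rewrite mulr_ge0 ?addr_ge0 ?mulr_ge0// /n.
have -> : K = K / (b - u) * (b - u) by rewrite mulfVK// gt_eqF.
apply: (path_length_le_const tnormG_ge0) => //.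
- by rewrite divr_ge0// ltW.
- exact: (speed_measurable (@tnormG_continuous R V) ub beC beG).
move=> t tub; have tub' := subset_itv_oo_cc tub.
rewrite /speed (derive1_slope (sl t)) beE /tnormG.
have UG := GOmega_GL (GOmega_Ubop (wpos _ (s01 _ tub'))).
have -> : bcomp (binv (bcomp g (Ubop (1J + s t *: w))))
    ((b - u)^-1 *: (A1 + (2 * ((t - u) / (b - u))) *: A2)) =
    (b - u)^-1 *: bcomp (binv (Ubop (1J + s t *: w)))
      (2 *: Lbop w + (2 * s t) *: Ubop w).
  rewrite -[RHS]bcompZr; set X := (b - u)^-1 *: (2 *: Lbop w + _).
  have -> : (b - u)^-1 *: (A1 + (2 * ((t - u) / (b - u))) *: A2) = bcomp g X.
    by rewrite /X bcompZr bcompDr bcompZr.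
  apply: bopP => v /=; set U := Ubop _ in UG *.
  apply: (can_inj (binvK' UG)); apply: (can_inj (binvK' gG)).
  by rewrite (binvK UG); exact: (binvK (GL_comp gG UG)).
rewrite normrZ gtr0_norm ?invr_gt0// mulrC ler_pM2r ?invr_gt0//.
exact/wn/s01.
Qed.

(** The lift g of the starting point is arbitrary, so that a lift of the next
    piece can start where the previous one ends; the error is additive. *)
Definition reach (ga : R -> V) e u b := forall g, GOmega g -> g 1J = ga u ->
  exists al : R -> bop V, [/\ path_in (@GOmega R V) g (al b) al u b,
    al b 1J = ga b & (path_length (@tnormG R V) al u b <=
      path_length (@tnormO R V) ga u b + (e * (b - u))%:E)%E].

Lemma reach_trans ga e u m b : u < m -> m < b ->
  measurable_fun `[u, b]%classic (EFin \o speed (@tnormO R V) ga) ->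
  reach ga e u m -> reach ga e m b -> reach ga e u b.
Proof.
move=> um mb mga rum rmb g gO gu.
have [al [[_ alC alS alu _] alm alL]] := rum g gO gu.
have [|be [[_ beC beS bem _] beb beL]] := rmb (al m) _ alm.
  by apply: alS; rewrite in_itv /= lexx ltW.
pose c t := if t <= m then al t else be t.
have cal : {in `[u, m], al =1 c} by move=> t; rewrite in_itv /c /= => /andP[_ ->].
have cbe : {in `[m, b], be =1 c}.
  move=> t; rewrite in_itv /c /= => /andP[mt _]; case: ifPn => // tm.
  by have -> : t = m by apply/eqP; rewrite eq_le tm.
have cC : piecewise_C1 c u b.
  apply: (piecewise_C1_cat um); [exact: piecewise_C1_ext alC|].
  exact: piecewise_C1_ext beC.
have cS t : t \in `[u, b] -> GOmega (c t).
  rewrite in_itv /c /= => /andP[ut tb]; case: ifPn => tm.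
    by apply: alS; rewrite in_itv /= ut.
  by apply: beS; rewrite in_itv /= tb ltW// ltNge.
have ub : u < b := lt_trans um mb.
have cb : c b = be b by rewrite /c leNgt mb.
exists c; split; last 2 first.
- by rewrite cb.
- have mc := speed_measurable (@tnormG_continuous R V) ub cC cS.
  have mal := speed_measurable (@tnormG_continuous R V) um alC alS.
  have mbe := speed_measurable (@tnormG_continuous R V) mb beC beS.
  rewrite (path_length_cat tnormG_ge0 um mb mc).
  rewrite -(path_length_ext cal mal) -(path_length_ext cbe mbe).
  rewrite (path_length_cat tnormO_ge0 um mb mga).
  have -> : e * (b - u) = e * (m - u) + e * (b - m) by ring.
  by rewrite EFinD [X in (_ <= X)%E]addeACA leeD.
- by split => //; rewrite /c (ltW um).
Qed.

(** The lift is at most O(n^2) longer than the chord, of norm n, while the path is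
    at least (phi - e / 4) (b - u) long; the last two hypotheses keep the excess
    below e (b - u). *)
Lemma reach_step (ga : R -> V) e phi u b : u < b -> 0 < e -> 0 <= phi ->
  (forall t, t \in `[u, b] -> Omega (ga t)) ->
  measurable_fun `[u, b]%classic (EFin \o speed (@tnormO R V) ga) ->
  tnormO (ga u) (slope ga u b) <= phi + e / 4 ->
  (forall t, t \in `]u, b[ -> phi - e / 4 <= speed (@tnormO R V) ga t) ->
  (b - u) * (phi + e / 4) <= 2^-1 ->
  (b - u) * (80 * (phi + e / 4) ^+ 2) <= e -> reach ga e u b.
Proof.
move=> ub e0 phi0 gaS mga le1 le2 h1 h2 g gO gu; have gG := GOmega_GL gO.
have h0 : 0 < b - u by rewrite subr_gt0.
set n := `|binv g (ga b) - 1J|.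
have nE : n = (b - u) * tnormO (ga u) (slope ga u b).
  have -> : n = `|binv g (ga b - ga u)|.
    by rewrite /n bopD bopN -gu (binvK' gG).
  rewrite -gu tnormO_GOmega// /slope bopZ normrZ gtr0_norm ?invr_gt0//.
  by rewrite mulrA mulfV ?mul1r ?gu// gt_eqF.
have n0 : 0 <= n by rewrite /n.
have nle : n <= (b - u) * (phi + e / 4) by rewrite nE ler_pM2l.
have [|al [alP alb alL]] := @orbit_step_path g (ga b) u b ub gO.
  exact: le_trans h1.
exists al; split => //; apply: (le_trans alL); rewrite -/n.
pose K := Num.max 0 (phi - e / 4).
have K0 : 0 <= K by rewrite le_max lexx.
have gaK : ((K * (b - u))%:E <= path_length (@tnormO R V) ga u b)%E.
  apply: path_length_ge_const => // t tub.
  by rewrite ge_max le2// tnormO_ge0.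
apply: (le_trans _ (leeD gaK (lexx _))); rewrite -EFinD lee_fin.
have KP : (phi - e / 4) * (b - u) <= K * (b - u).
  by rewrite ler_wpM2r ?(ltW h0)// le_max lexx orbT.
set q := phi + e / 4 in le1 h1 h2 nle.
have q0 : 0 <= q by rewrite /q; lra.
have nn : n * n <= ((b - u) * q) * ((b - u) * q) by exact: ler_pM.
have hh : (b - u) * ((b - u) * (80 * q ^+ 2)) <= (b - u) * e.
  by rewrite ler_wpM2l// ltW.
have -> : n * (1 + 40 * n) = n + 40 * (n * n) by ring.
have E1 : (b - u) * ((b - u) * (80 * q ^+ 2)) =
  80 * (((b - u) * q) * ((b - u) * q)) by ring.
have E2 : (b - u) * q = (b - u) * phi + (b - u) * (e / 4) by rewrite /q; ring.
rewrite E1 in hh; move: nn hh; set X := (b - u) * q * _ => nn hh.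
rewrite E2 in nle; move: KP nle.
have -> : (phi - e / 4) * (b - u) = (b - u) * phi - (b - u) * (e / 4) by ring.
have -> : (b - u) * (e / 4) = (b - u) * e / 4 by ring.
have -> : e * (b - u) = (b - u) * e by ring.
have : 0 <= (b - u) * e by rewrite mulr_ge0// ltW.
set Y := (b - u) * e in hh *; set Z := (b - u) * phi; set W := K * (b - u).
lra.
Qed.

Lemma reach_path (ga : R -> V) (p p' : V) e a b : 0 < e ->
  path_in (@Omega R V) p p' ga a b -> reach ga e a b.
Proof.
move=> e0 [ab gaC gaS _ _].
have mga := speed_measurable (@tnormO_continuous R V) ab gaC gaS.
have sub (u v t : R) : a <= u -> v <= b -> t \in `[u, v] -> t \in `[a, b].
  move=> au vb; rewrite !in_itv /= => /andP[ut tv].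
  by rewrite (le_trans au)//= (le_trans tv).
have mS (u v : R) : a <= u -> v <= b ->
    measurable_fun `[u, v]%classic (EFin \o speed (@tnormO R V) ga).
  move=> au vb; apply: measurable_funS mga => // t; exact: sub.
have gaS' (u v t : R) : a <= u -> v <= b -> t \in `[u, v] -> Omega (ga t).
  by move=> au vb tuv; apply/gaS/(sub u v).
have e4 : 0 < e / 4 by rewrite divr_gt0.
(* The limit speed phi is nonnegative, and short steps satisfy the smallness
   conditions of the step estimate. *)
have phi_ge0 (phi t : R) : (forall d, 0 < d ->
    exists s, chord_speed (@tnormO R V) ga t s phi d) -> 0 <= phi.
  move=> H; rewrite leNgt; apply/negP => phi0.
  have [|s [+ _ _]] := H (- phi); first by rewrite oppr_gt0.
  have := tnormO_ge0 (ga t) (slope ga t s); rewrite ltr_norml => ? /andP[_]; lra.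
have small (phi : R) : 0 <= phi -> exists2 d : R, 0 < d & forall h : R, 0 < h < d ->
    h * (phi + e / 4) <= 2^-1 /\ h * (80 * (phi + e / 4) ^+ 2) <= e.
  move=> phi0; set q := phi + e / 4; have q0 : 0 < q by rewrite ltr_wpDl.
  have q80 : 0 < 80 * q ^+ 2 by rewrite mulr_gt0// exprn_gt0.
  exists (Num.min (2^-1 / q) (e / (80 * q ^+ 2))).
    by rewrite lt_min !divr_gt0// invr_gt0.
  move=> h /andP[h0]; rewrite lt_min => /andP[h1 h2].
  by split; rewrite -ler_pdivlMr// ltW.
apply: interval_induction => //.
- by move=> u m v au um mv vb; apply: reach_trans => //; exact: mS.
- move=> t /andP[at_ tb].
  have [|phi Hphi] := speed_right (@tnormO_continuous R V) ab gaC gaS (t := t).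
    by rewrite at_.
  have phi0 : 0 <= phi.
    apply: (phi_ge0 phi t) => d d0; have [d' d'0 H] := Hphi d d0.
    exists (t + d' / 2); apply: H.
    by apply/andP; split; lra.
  have [d d0 H] := Hphi _ e4; have [d2 d20 H2] := small phi phi0.
  exists (Num.min d d2); first by rewrite lt_min d0.
  move=> v /andP[tv]; rewrite -ltrBlDl lt_min => /andP[vd vd2] vb.
  have [|h1 h2] := H2 (v - t); first by rewrite subr_gt0 tv.
  apply: (@reach_step ga e phi t v) => //.
  + by move=> s; exact: gaS'.
  + exact: mS.
  + have [|+ _ _] := H v; first by rewrite tv -ltrBlDl.
    by rewrite ltr_norml => /andP[_]; lra.
  + move=> s; rewrite in_itv /= => /andP[ts sv].
    have [|_ _] := H s; first by rewrite ts; lra.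
    by rewrite ltr_norml => /andP[+ _]; lra.
- move=> t /andP[at_ tb].
  have [|phi Hphi] := speed_left (@tnormO_continuous R V) ab gaC gaS (t := t).
    by rewrite at_.
  have phi0 : 0 <= phi.
    apply: (phi_ge0 phi t) => d d0; have [d' d'0 H] := Hphi d d0.
    exists (t - d' / 2); apply: H.
    by apply/andP; split; lra.
  have [d d0 H] := Hphi _ e4; have [d2 d20 H2] := small phi phi0.
  exists (Num.min d d2); first by rewrite lt_min d0.
  move=> u /andP[+ ut] au; rewrite ltrBlDl -ltrBlDr lt_min => /andP[ud ud2].
  have [|h1 h2] := H2 (t - u); first by rewrite subr_gt0 ut.
  apply: (@reach_step ga e phi u t) => //.
  + by move=> s; exact: gaS'.
  + exact: mS.
  + have [|_ + _] := H u; first by rewrite ut andbT; lra.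
    by rewrite slopeC ltr_norml => /andP[_]; lra.
  + move=> s; rewrite in_itv /= => /andP[us st].
    have [|_ _] := H s; first by rewrite st andbT; lra.
    by rewrite ltr_norml => /andP[+ _]; lra.
Qed.

Lemma AutV_bid : AutV (bid V).
Proof. by split=> //; exists (bid V); apply/is_binvP. Qed.

Lemma distO_le_dprime x y : Omega x -> Omega y -> (distO x y <= dprime x y)%E.
Proof.
move=> xO yO; have [gO gx] := orbit_liftP xO; have [hO hy] := orbit_liftP yO.
apply: le_ereal_inf_tmp => _ [[k1 k2] [[_ k11 _] [_ k21 _]] <-] /=.
apply: le_ereal_inf_tmp => _ [al [a [b [alP ->]]]].
have [gaP gaL] := path_length_orbit alP; apply: le_trans gaL.
apply: ereal_inf_lbound; exists (fun t => al t 1J), a, b; split => //.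
by move: gaP; rewrite /= k11 k21 gx hy.
Qed.

Lemma dprime_le_distO x y : Omega x -> Omega y -> (dprime x y <= distO x y)%E.
Proof.
move=> xO yO; have [gO gx] := orbit_liftP xO; have [hO hy] := orbit_liftP yO.
set g := orbit_lift x in gO gx *; set h := orbit_lift y in hO hy *.
apply: le_ereal_inf_tmp => _ [ga [a [b [gaP ->]]]]; apply/lee_addgt0Pr => e e0.
have [ab _ _ gaa gab] := gaP; have ba0 : 0 < b - a by rewrite subr_gt0.
have [|al [alP alb alL]] := reach_path (divr_gt0 e0 ba0) gaP gO.
  by rewrite gx gaa.
rewrite mulfVK ?gt_eqF// in alL; apply: le_trans alL.
have [_ _ alS _ _] := alP.
have albO : GOmega (al b) by apply: alS; rewrite in_itv /= lexx ltW.
have hG := GOmega_GL hO.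
pose k2 := bcomp (binv h) (al b).
have k2O : GOmega k2 by apply: GOmega_comp => //; exact: GOmega_binv.
have k21 : k2 1J = 1J by rewrite /= alb gab -hy (binvK' hG).
apply: le_trans (_ : (distG (bcomp g (bid V)) (bcomp h k2) <= _)%E).
  apply: ereal_inf_lbound; exists (bid V, k2) => //; split => /=.
    exact: AutV_bid.
  exact: unital_GOmega_Aut.
have -> : bcomp g (bid V) = g by exact: bopP.
have -> : bcomp h k2 = al b by apply: bopP => v /=; rewrite [LHS](binvK hG).
by apply: ereal_inf_lbound; exists al, a, b.
Qed.

End OrbitPaths.

Theorem theorem5p14 (R : realType) (V : jbAlgType R) (x y : V)
  (xO : Omega x) (yO : Omega y) : dprime x y = distO x y.
Proof.
by apply/eqP; rewrite eq_le dprime_le_distO// distO_le_dprime.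
Qed.
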